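(* Let $X$ be a complex sequence space with normalized $1$-unconditional basis $\{e_1,\dots,e_k\}$, $k\in\mathbb{N}\cup\{\infty\}$, and norm $N$. Let $X=X_0(X_1,\dots,X_m)$, where $X_1,\dots,X_m$ are factors of $X$ (in the sense defined in the context) and $N_0$ is the norm of $X_0$. Then a linear map $T:X\to X$ is a surjective isometry of $X$ if and only if there exist a permutation $\pi$ of $\{1,\dots,m\}$ such that the norm $N_0$ on $X_0$ satisfies $N_0(z_1,\dots,z_m)=N_0(z_{\pi(1)},\dots,z_{\pi(m)})$ for all $(z_1,\dots,z_m)\in X_0$, and a family of surjective linear isometries $S_j:X_{\pi(j)}\to X_j$ such that $$T(x_1,\dots,x_m)=(S_1x_{\pi(1)},\dots,S_mx_{\pi(m)})$$ for all $(x_1,\dots,x_m)\in X_0(X_1,\dots,X_m)=X$.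
   Context: A complex sequence space with normalized $1$-unconditional basis is a finite- or infinite-dimensional complex (Banach) space with norm $N$ and a basis $\{e_1,\dots,e_k\}$ such that $N(\sum a_ie_i)=N(\sum|a_i|e_i)$ (that is, $N$ is an absolute norm) and $N(e_i)=1$ for all $i$. When $k=\infty$, $\{1,\dots,k\}$ means $\mathbb{N}$, and span means closed linear span. The number $m$ of factors may be infinite. Fiber: a non-empty proper subset $S\subset\{1,\dots,k\}$ is a fiber of $X$ if for all scalars $a_s,a'_s$ ($s\in S$), $N(\sum_{s\in S}a_se_s)=N(\sum_{s\in S}a'_se_s)$ implies $N(\sum_{s\in S}a_se_s+\sum_{i\notin S}b_ie_i)=N(\sum_{s\in S}a'_se_s+\sum_{i\notin S}b_ie_i)$ for all scalars $b_i$, $i\notin S$. A fiber is maximal if it is maximal with respect to inclusion among fibers. Cross product: if $X_0$ is a sequence space of dimension $m$ with absolute norm $N_0$, then $X=X_0(X_1,\dots,X_m)$ means $N(x)=N_0(N(x_1),\dots,N(x_m))$ for every $x=(x_1,\dots,x_m)\in X$, $x_i\in X_i$ (each $X_i$ carries the restriction of $N$). If $X_0=\ell_p^m$ this is written $\ell_p(X_1,\dots,X_m)$ and called an $\ell_p$-sum. Factors: $X_1,\dots,X_m$ are factors of $X$ if there is a partition $S_1,\dots,S_m$ of $\{1,\dots,k\}$ such that $X$ is the direct sum of $X_i=\operatorname{span}\{e_s:s\in S_i\}$, $1\le i\le m$, and one of the following holds. (i) Every $S_i$ is a maximal fiber and $X=X_0(X_1,\dots,X_m)$, where the norm on $X_0$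 is $N_0(a_1,\dots,a_m)=N(\sum_{i=1}^m a_ie_{s_i})$ for some $s_i\in S_i$. (ii) There exists $1\le p\le\infty$ such that $X=\ell_p(X_1,\dots,X_m)$ (so $X_0=\ell_p^m$), where at most one of the $X_i$'s equals $\ell_p^{\dim X_i}$ (in coordinates with respect to the basis vectors $e_s$, $s\in S_i$), and all the remaining $X_i$ satisfy $\dim X_i\ge2$ and are not an $\ell_p$-sum of two nonzero subspaces.
   Formalization: The case X = ℓ_2^2 split into its two coordinate lines (k = m = 2) is excluded: there {1} and {2} are maximal fibers, so (i) holds, but a rotation by 45° is a surjective isometry that is not of the stated form. *)

(* Defs.v *)
From HB Require Import structures.
From mathcomp Require Export all_boot all_order all_algebra.
From mathcomp Require Export all_classical all_reals all_analysis.
From mathcomp Require Export complex.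
Export Order.TTheory GRing.Theory Num.Theory.
Export numFieldNormedType.Exports.

Set Implicit Arguments.
Unset Strict Implicit.
Unset Printing Implicit Defensive.

Local Open Scope classical_set_scope.
Local Open Scope ring_scope.

(* A dimension in N u {oo}: [Some n] is n and [None] is oo. Indices are
   0-based. *)
Definition indices (k : option nat) : set nat :=
  if k is Some n then `I_n else setT.

(* The norm of a normed space over R[i] takes its values in R[i]; they are
   nonnegative reals, so this loses nothing. *)
Definition rnorm (R : realType) (V : normedZmodType R[i]) (v : V) : R :=
  complex.Re `|v|.

Section Sums.
Variables (R : realType).
Implicit Types V W X : normedModType R[i].

(* \sum_(i in D) u i = x in norm. *)
Definition sums_to V (D : set nat) (u : nat -> V) (x : V) : Prop :=
  (fun n => \sum_(0 <= i < n | i \in D) u i) @ \oo --> x.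

(* N(\sum_(i in D) u i) = N'(\sum_(i in D) v i) as soon as the left-hand sum
   exists; the existence of the right-hand sum is part of the claim. *)
Definition eq_norm_sum V W (D : set nat) (u : nat -> V) (v : nat -> W) : Prop :=
  forall x, sums_to D u x -> exists2 y, sums_to D v y & `|x| = `|y|.

(* The l_p norm (1 <= p <= +oo) of the family of the norms of the u i, i in D.
   It is also used for scalar families, R[i] being normed by the modulus. *)
Definition lpnorm (V : normedZmodType R[i]) (p : \bar R) (D : set nat)
    (u : nat -> V) : \bar R :=
  Lnorm counting p (fun i => if i \in D then (rnorm (u i))%:E else 0%E).

Definition schauder_basis V (D : set nat) (e : nat -> V) : Prop :=
  (forall x, exists a : nat -> R[i], sums_to D (fun i => a i *: e i) x) /\
  (forall x (a b : nat -> R[i]), sums_to D (fun i => a i *: e i) x ->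
     sums_to D (fun i => b i *: e i) x -> forall i, D i -> a i = b i).

Definition normalized_unconditional_basis V (D : set nat) (e : nat -> V) :
    Prop :=
  [/\ schauder_basis D e,
      forall i, D i -> `|e i| = 1 &
      forall a : nat -> R[i],
        eq_norm_sum D (fun i => a i *: e i) (fun i => `|a i| *: e i)].

Definition closed_span V (S : set nat) (e : nat -> V) : set V :=
  closure [set \sum_(0 <= i < na.1 | i \in S) na.2 i *: e i
          | na in [set: nat * (nat -> R[i])]].

Definition fiber V (D : set nat) (e : nat -> V) (S : set nat) : Prop :=
  [/\ S !=set0, S `<` D &
      forall (a a' b : nat -> R[i]) (x x' y : V),
        sums_to S (fun i => a i *: e i) x ->
        sums_to S (fun i => a' i *: e i) x' ->
        sums_to (D `\` S) (fun i => b i *: e i) y ->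
        `|x| = `|x'| -> `|x + y| = `|x' + y|].

Definition maximal_fiber V (D : set nat) (e : nat -> V) (S : set nat) : Prop :=
  fiber D e S /\ forall S', fiber D e S' -> S `<=` S' -> S' = S.

(* x = (xs j)_(j in M) with xs j in Y j. *)
Definition components V (M : set nat) (Y : nat -> set V) (x : V)
    (xs : nat -> V) : Prop :=
  (forall j, M j -> Y j (xs j)) /\ sums_to M xs x.

Definition direct_sum V (M : set nat) (Y : nat -> set V) : Prop :=
  (forall x, exists xs, components M Y x xs) /\
  (forall x xs ys, components M Y x xs -> components M Y x ys ->
     forall j, M j -> xs j = ys j).

(* X = X0(Y_j : j in M), where f is the basis of X0. *)
Definition cross_product X X0 (M : set nat) (f : nat -> X0)
    (Y : nat -> set X) : Prop :=
  direct_sum M Y /\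
  forall xs, (forall j, M j -> Y j (xs j)) ->
    eq_norm_sum M xs (fun j => `|xs j| *: f j).

(* The closed span of (e i)_(i in D) is l_p in these coordinates. For infinite
   D and p = +oo this is c_0, as e is a basis. *)
Definition is_lp V (p : \bar R) (D : set nat) (e : nat -> V) : Prop :=
  forall (a : nat -> R[i]) x, sums_to D (fun i => a i *: e i) x ->
    (rnorm x)%:E = lpnorm p D a.

Definition lp_sum_of_two V (p : \bar R) (Y : set V) : Prop :=
  exists Y1 Y2 : set V,
    [/\ submod_closed (mem Y1) /\ submod_closed (mem Y2),
        Y1 <> [set 0] /\ Y2 <> [set 0],
        Y = [set y1 + y2 | y1 in Y1 & y2 in Y2] &
        forall y1 y2, Y1 y1 -> Y2 y2 ->
          (rnorm (y1 + y2))%:E =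
          lpnorm p `I_2 (fun i => if i == 0%N then y1 else y2)].

(* X, with basis (e i)_(i in D), is X0(X_j : j in M), X0 having the basis
   (f j)_(j in M), and the X_j = closed_span (S j) e are factors of X. *)
Definition factors X X0 (D : set nat) (e : nat -> X) (M : set nat)
    (f : nat -> X0) (S : nat -> set nat) : Prop :=
  [/\ partition M S D,
      cross_product M f (fun j => closed_span (S j) e) &
      ((forall j, M j -> maximal_fiber D e (S j)) /\
       exists2 s : nat -> nat, (forall j, M j -> S j (s j)) &
         forall a : nat -> R[i],
           eq_norm_sum M (fun j => a j *: f j) (fun j => a j *: e (s j)))
      \/
      (exists p : \bar R,
         [/\ (1 <= p)%E, is_lp p M f,
             forall i j, M i -> M j ->
               is_lp p (S i) e -> is_lp p (S j) e -> i = j &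
             forall j, M j -> ~ is_lp p (S j) e ->
               (* dim X_j is the cardinal of S j *)
               (`I_2 #<= S j)%card /\
               ~ lp_sum_of_two p (closed_span (S j) e)])].

Definition linear_on V W (Y : set V) (F : V -> W) : Prop :=
  forall (c : R[i]) x y, Y x -> Y y -> F (c *: x + y) = c *: F x + F y.

Definition surjective_isometry V W (Y : set V) (Z : set W) (F : V -> W) : Prop :=
  [/\ set_fun Y Z F, set_surj Y Z F & forall x, Y x -> `|F x| = `|x|].

(* X = l_2^2, cut into its two coordinate lines. In l_2^2 the sets {0} and {1}
   are maximal fibers (fibers are proper subsets), so this is an instance of the
   first alternative of [factors]; but a rotation of l_2^2 is an isometry that
   does not permute the two lines. For the other cutting (m = 1, second
   alternative) there is nothing to exclude. *)
Definition l22_in_lines V (k m : option nat) (e : nat -> V) : Prop :=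
  [/\ k = Some 2%N, m = Some 2%N & is_lp 2%:E (indices k) e].

End Sums.

(* Main.v *)
Require Import Defs.
From mathcomp Require Import ring lra zify.

(** The idea, due to Kalton and Wood, is that the surjective isometries of a
    complex space with a 1-unconditional basis are rigid up to rotations of
    Hilbert subspaces spanned by basis vectors.

    Let T be a surjective isometry of X with inverse T'. For |w| = 1 the operator
    multiplying one coordinate c by w is an isometry, hence so is its conjugate by
    T. Therefore the projection of index c conjugated by T, which has the entries
    [co (T (e c)) a * co (T' (e b)) c], is hermitian. Hermitian operators form a
    real vector space invariant under conjugation by sign changes, so that the
    entries (a, b) and (b, a) alone also give a hermitian operator
    ([hermitian_two_coordinates]). It generates a flow in the plane of a and b
    that preserves the norm of X; if it is not 0, the orbits are circles and the
    norm depends on the coordinates a and b only through their Euclidean norm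
    ([plane_rotation]). The indices are thereby divided into blocks
    ([same_hilbert_block]), and the image of a basis vector is supported by one
    block ([support_block]). It follows that, for every union S of blocks, T maps
    the coordinate subspaces of S and of its complement onto those of some set of
    indices and of its complement ([image_support_sub], [image_support_inv],
    [image_support_invC]).

    Next, the parts of the decomposition into factors are unions of blocks and
    every isometry maps a part into a part. If the parts are maximal fibers, this
    follows from the fact that two fibers that meet have a union which is a fiber
    or everything: every fiber lies in a single part ([fiber_in_part]), in
    particular each block and the image of each part. The only obstruction is
    that a block may be everything, in which case X is a Hilbert space, and its
    partition into maximal fibers is the excluded one of a plane into two lines
    ([maximal_fiber_one_block]). If the parts form an l_p-sum, a block meeting two
    parts would split an indecomposable part into a line and the rest
    ([lp_saturated]), and intersecting an indecomposable part with the image of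
    the decomposition shows that it lies in the image of a single part
    ([indecomposable_image]); the l_p part is then mapped to itself.

    Applied to T and T', this gives the permutation of the parts
    ([exists_part_permutation]), and the invariance of the norm of X0 is obtained
    by applying T to vectors with one coordinate in each part. Conversely, the
    norm of T x is a value of the norm of X0 at permuted arguments, and T is
    surjective because the inverse permutation also preserves convergence in X0
    ([sums_to_permuted]). *)

Set Implicit Arguments.
Unset Strict Implicit.
Unset Printing Implicit Defensive.

Local Open Scope classical_set_scope.
Local Open Scope ring_scope.

Local Notation "x %:C" := (real_complex _ x) : ring_scope.

(** * Real norms and norm-convergent sums *)

Section RealNorm.
Variables (R : realType) (V : normedModType R[i]).
Implicit Types (x y : V) (c : R[i]).

Lemma rnormE (W : normedZmodType R[i]) (w : W) : `|w| = (rnorm w)%:C.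
Proof.
have := normr_ge0 w; rewrite /rnorm; case: `|w| => a b /=.
by rewrite lecE /= => /andP[/eqP -> _].
Qed.

Lemma rnorm_inj (W W' : normedZmodType R[i]) (w : W) (w' : W') :
  rnorm w = rnorm w' -> `|w| = `|w'|.
Proof. by move=> h; rewrite !rnormE h. Qed.

Lemma rnorm_ge0 (W : normedZmodType R[i]) (w : W) : 0 <= rnorm w.
Proof. by rewrite -lecR -rnormE; exact: normr_ge0. Qed.

Lemma rnorm0 (W : normedZmodType R[i]) : rnorm (0 : W) = 0.
Proof. by rewrite /rnorm normr0. Qed.

Lemma rnorm0_eq0 (W : normedZmodType R[i]) (w : W) : rnorm w = 0 -> w = 0.
Proof. by move=> h; apply/normr0_eq0; rewrite rnormE h. Qed.

Lemma rnormN (W : normedZmodType R[i]) (w : W) : rnorm (- w) = rnorm w.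
Proof. by rewrite /rnorm normrN. Qed.

Lemma rnormD (W : normedZmodType R[i]) (w w' : W) :
  rnorm (w + w') <= rnorm w + rnorm w'.
Proof. by rewrite -lecR rmorphD /= -!rnormE ler_normD. Qed.

Lemma rnormB (W : normedZmodType R[i]) (w w' : W) :
  rnorm (w - w') <= rnorm w + rnorm w'.
Proof. by rewrite -(rnormN w') rnormD. Qed.

Lemma rdistC (W : normedZmodType R[i]) (w w' : W) :
  rnorm (w - w') = rnorm (w' - w).
Proof. by rewrite -rnormN opprB. Qed.

Lemma rnorm_le_dist (W : normedZmodType R[i]) (w w' : W) :
  rnorm w <= rnorm w' + rnorm (w - w').
Proof. by rewrite -[X in rnorm X <= _](subrK w') addrC rnormD. Qed.

Lemma rnormZ c x : rnorm (c *: x) = rnorm c * rnorm x.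
Proof.
by apply: (@complexI R); rewrite rmorphM /= -!rnormE normrZ.
Qed.

Lemma rnormM c c' : rnorm (c * c') = rnorm c * rnorm c'.
Proof. by apply: (@complexI R); rewrite rmorphM /= -!rnormE normrM. Qed.

Lemma rnorm1 : rnorm (1 : R[i]) = 1.
Proof. by rewrite /rnorm normr1. Qed.

Lemma rnormcV (z : R[i]) : rnorm z^-1 = (rnorm z)^-1.
Proof.
by apply: (@complexI R); rewrite fmorphV -!rnormE normfV.
Qed.

Lemma rnormR (r : R) : rnorm r%:C = `|r|.
Proof. by rewrite /rnorm normc_def /= expr0n addr0 sqrtr_sqr. Qed.

Lemma rnormc (z : R[i]) :
  rnorm z = Num.sqrt (complex.Re z ^+ 2 + complex.Im z ^+ 2).
Proof. by rewrite /rnorm normc_def. Qed.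

Lemma Re_le_rnorm (z : R[i]) : complex.Re z <= rnorm z.
Proof.
apply: le_trans (ler_norm _) _.
by rewrite rnormc -sqrtr_sqr ler_wsqrtr // lerDl sqr_ge0.
Qed.

Lemma rnorm_norm (W : normedZmodType R[i]) (w : W) :
  rnorm `|w| = rnorm w.
Proof. by rewrite rnormE rnormR ger0_norm // rnorm_ge0. Qed.

(** Limits are handled by real epsilons instead of filters on [V], because all
    the estimates below are inequalities between real norms. *)
Lemma sums_toP (D : set nat) (u : nat -> V) x :
  sums_to D u x <-> forall eps : R, 0 < eps -> exists N, forall n, (N <= n)%N ->
    rnorm (x - \sum_(0 <= i < n | i \in D) u i) < eps.
Proof.
split.
  move=> /cvgrPdist_lt h eps e0.
  have /h [N _ hN] : 0 < eps%:C by rewrite ltcR.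
  by exists N => n /hN /=; rewrite rnormE ltcR.
move=> h; apply/cvgrPdist_lt => -[a b].
rewrite ltcE /= => /andP[/eqP -> a0].
have [N hN] := h _ a0; exists N => // n /= /hN; by rewrite rnormE ltcR.
Qed.

Lemma rnorm_small_eq0 (W : normedZmodType R[i]) (w : W) :
  (forall eps : R, 0 < eps -> rnorm w <= eps) -> w = 0.
Proof.
move=> h; apply: rnorm0_eq0; apply/le_anti; rewrite rnorm_ge0 andbT.
by apply/ler_addgt0Pl => e e0; rewrite addr0 h.
Qed.

Lemma sums_to_uniq (D : set nat) (u : nat -> V) x y :
  sums_to D u x -> sums_to D u y -> x = y.
Proof.
move=> /sums_toP hx /sums_toP hy; apply/eqP; rewrite -subr_eq0; apply/eqP.
apply: rnorm_small_eq0 => eps e0.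
have e2 : 0 < eps / 2 by rewrite divr_gt0.
have [N hN] := hx _ e2; have [M hM] := hy _ e2.
have := hN _ (leq_maxl N M); have := hM _ (leq_maxr N M).
set s := \sum_(_ <= _ < _ | _) _ => h1 h2.
rewrite -(subrKA s); apply: (le_trans (rnormD _ _)).
by rewrite (rdistC s); lra.
Qed.

Lemma rnorm_eq_approx (U W : normedZmodType R[i]) (x : U) (y : W) :
  (forall eps : R, 0 < eps -> exists s t,
     [/\ rnorm (x - s) < eps, rnorm (y - t) < eps & rnorm s = rnorm t]) ->
  rnorm x = rnorm y.
Proof.
move=> h; apply/le_anti/andP; split; apply/ler_addgt0Pl => eps e0.
  have [s [t [hs ht E]]] := h _ (divr_gt0 e0 (ltr0n _ 2)).
  have := rnorm_le_dist x s; have := rnorm_le_dist t y.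
  by rewrite rdistC E; lra.
have [s [t [hs ht E]]] := h _ (divr_gt0 e0 (ltr0n _ 2)).
have := rnorm_le_dist y t; have := rnorm_le_dist s x.
by rewrite rdistC E; lra.
Qed.

Lemma sums_to_eq (D : set nat) (u v : nat -> V) x :
  sums_to D u x -> (forall i, D i -> u i = v i) -> sums_to D v x.
Proof.
move=> /sums_toP h uv; apply/sums_toP => eps /h[N hN]; exists N => n /hN.
congr (rnorm (_ - _) < _); apply: eq_bigr => i; rewrite inE; exact: uv.
Qed.

Lemma sums_toZD (D : set nat) (u v : nat -> V) c x y :
  sums_to D u x -> sums_to D v y ->
  sums_to D (fun i => c *: u i + v i) (c *: x + y).
Proof.
move=> /sums_toP hx /sums_toP hy; apply/sums_toP => eps e0.
have c0 : 0 < rnorm c + 1 by have := rnorm_ge0 c; lra.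
have ec : 0 < eps / 2 / (rnorm c + 1) by rewrite !divr_gt0.
have e2 : 0 < eps / 2 by rewrite divr_gt0.
have [N hN] := hx _ ec; have [M hM] := hy _ e2.
exists (maxn N M) => n; rewrite geq_max => /andP[/hN h1 /hM h2].
rewrite big_split /= -scaler_sumr opprD addrACA -scalerBr.
apply: (le_lt_trans (rnormD _ _)); rewrite rnormZ.
rewrite ltr_pdivlMr // in h1.
set A := rnorm (x - _) in h1 *; set B := rnorm _ in h2 *.
have : 0 <= A by exact: rnorm_ge0.
have : 0 <= rnorm c by exact: rnorm_ge0.
nra.
Qed.

Lemma sums_to_fin (D : set nat) (u : nat -> V) n :
  (forall i, D i -> (n <= i)%N -> u i = 0) ->
  sums_to D u (\sum_(0 <= i < n | i \in D) u i).
Proof.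
move=> h; apply/sums_toP => eps e0; exists n => m nm.
rewrite [X in _ - X](big_cat_nat (leq0n n) nm) /=.
have -> : \sum_(n <= i < m | i \in D) u i = 0; last first.
  by rewrite addr0 subrr rnorm0.
rewrite big_nat_cond big1 // => i /andP[/andP[ni _]].
by rewrite inE => Di; rewrite h.
Qed.

Lemma sums_to1 (D : set nat) (u : nat -> V) j : D j ->
  (forall i, D i -> i <> j -> u i = 0) -> sums_to D u (u j).
Proof.
move=> Dj h; have : sums_to D u (\sum_(0 <= i < j.+1 | i \in D) u i).
  by apply: sums_to_fin => i Di ji; apply: h => // E; rewrite E ltnn in ji.
rewrite big_mkcond big_nat_recr //= mem_set // big_nat_cond big1 ?add0r //.
move=> i /andP[/andP[_ ij] _]; case: ifP => //; rewrite inE => Di.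
by apply: h => // E; rewrite E ltnn in ij.
Qed.

Lemma sums_to_sub (D S : set nat) (u : nat -> V) x : S `<=` D ->
  (forall i, D i -> ~ S i -> u i = 0) -> sums_to S u x <-> sums_to D u x.
Proof.
move=> SD h.
suff E n : \sum_(0 <= i < n | i \in S) u i = \sum_(0 <= i < n | i \in D) u i.
  by split=> /sums_toP H; apply/sums_toP => eps /H[N hN]; exists N => n /hN;
    rewrite ?E // -E.
rewrite big_mkcond [RHS]big_mkcond; apply: eq_bigr => i _.
case: ifPn => [/set_mem Si|/negP nSi]; first by rewrite mem_set //; exact: SD.
case: ifPn => // /set_mem Di; rewrite h // => Si; apply: nSi; exact: mem_set.
Qed.

End RealNorm.
Arguments sums_to_eq : clear implicits.
Arguments sums_to_eq {R V D u v x}.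
Arguments sums_toZD : clear implicits.
Arguments sums_toZD {R V D u v} c {x y}.
Arguments sums_to_fin : clear implicits.
Arguments sums_to_fin {R V D u} n.
Arguments sums_to1 : clear implicits.
Arguments sums_to1 {R V D} u {j}.

Section Complete.
Variables (R : realType) (V : normedModType R[i]) (W : completeNormedModType R[i]).

Lemma sums_to_cauchy (D : set nat) (u : nat -> W) :
  (forall eps : R, 0 < eps -> exists N, forall n m, (N <= n)%N -> (n <= m)%N ->
     rnorm (\sum_(n <= i < m | i \in D) u i) < eps) ->
  exists x, sums_to D u x.
Proof.
move=> h.
set s := fun n => \sum_(0 <= i < n | i \in D) u i.
have cs : cauchy (s @ \oo).
  apply/cauchyP => -[a b]; rewrite ltcE /= => /andP[/eqP -> a0].
  have [N hN] := h _ a0.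
  exists (s N), N => // n /= Nn; rewrite -ball_normE /= distrC.
  have -> : s n - s N = \sum_(N <= i < n | i \in D) u i.
    rewrite /s (big_cat_nat (leq0n N) Nn) /=.
    by rewrite addrAC subrr add0r.
  by rewrite rnormE ltcR hN.
have /cvg_ex[x hx] : cvg (s @ \oo) by exact: cauchy_cvg.
by exists x.
Qed.

(** Convergence and the norm of the sum depend only on the norms of the sums
    over finite intervals; this is how sums are transported between spaces. *)
Lemma sums_transfer (D : set nat) (u : nat -> W) (v : nat -> V) y :
  (forall n m, rnorm (\sum_(n <= i < m | i \in D) u i) =
               rnorm (\sum_(n <= i < m | i \in D) v i)) ->
  sums_to D v y -> exists2 x, sums_to D u x & rnorm x = rnorm y.
Proof.
move=> uv /[dup] hv /sums_toP hvP.
have [x hx] : exists x, sums_to D u x.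
  apply: sums_to_cauchy => eps e0.
  have [N hN] := hvP _ (divr_gt0 e0 (ltr0n _ 2)).
  exists N => n m Nn nm; rewrite uv.
  have -> : \sum_(n <= i < m | i \in D) v i =
     (y - \sum_(0 <= i < n | i \in D) v i)
     - (y - \sum_(0 <= i < m | i \in D) v i).
    rewrite (big_cat_nat (leq0n n) nm) /= opprB [RHS]addrC subrKA.
    by rewrite addrAC subrr add0r.
  apply: (le_lt_trans (rnormB _ _)).
  have := hN _ Nn; have := hN _ (leq_trans Nn nm); lra.
exists x => //; apply: rnorm_eq_approx => eps e0.
have [N hN] := hvP _ e0; have /sums_toP/(_ _ e0)[M hM] := hx.
exists (\sum_(0 <= i < maxn N M | i \in D) u i).
exists (\sum_(0 <= i < maxn N M | i \in D) v i).
by split; [exact: hM (leq_maxr _ _)|exact: hN (leq_maxl _ _)|exact: uv].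
Qed.

End Complete.

(** * Coordinates with respect to a 1-unconditional basis *)

(** Made total by the value 0 outside D, so that identities between coordinates
    need no side condition on the index. *)
Definition coef (R : realType) (X : normedModType R[i]) (D : set nat)
    (e : nat -> X) (x : X) (i : nat) : R[i] :=
  if i \in D then
    xget (fun=> 0) [set a : nat -> R[i] | sums_to D (fun i => a i *: e i) x] i
  else 0.

(** For S included in D this is the closed span of the [e i], i in S; membership
    is checked coordinate by coordinate. *)
Definition coord_subspace (R : realType) (X : normedModType R[i]) (D : set nat)
    (e : nat -> X) (S : set nat) : set X :=
  [set x | forall i, ~ S i -> coef D e x i = 0].

Section Coordinates.
Variables (R : realType) (X : completeNormedModType R[i]).
Variables (D : set nat) (e : nat -> X).
Hypothesis basis_e : normalized_unconditional_basis D e.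
Local Notation co := (coef D e).
Local Notation XS := (coord_subspace D e).
Implicit Types (x y z : X) (c : R[i]).

Lemma coef_sum x : sums_to D (fun i => co x i *: e i) x.
Proof.
have [[h _] _ _] := basis_e.
have [a ha] := h x.
have := xgetPex (fun=> 0) (ex_intro
  [set a : nat -> R[i] | sums_to D (fun i => a i *: e i) x] a ha).
by move/sums_to_eq; apply => i Di; rewrite /coef mem_set.
Qed.
Arguments coef_sum : clear implicits.

Lemma coef_out x i : ~ D i -> co x i = 0.
Proof. by move=> nDi; rewrite /coef memNset. Qed.

Lemma coef_uniq (a : nat -> R[i]) x i :
  sums_to D (fun i => a i *: e i) x -> D i -> co x i = a i.
Proof.
by have [[_ h] _ _] := basis_e; move=> ha; exact: (h _ _ _ (coef_sum x) ha).
Qed.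

Lemma coef_inj x y : (forall i, co x i = co y i) -> x = y.
Proof.
move=> h; apply: sums_to_uniq (coef_sum x) _.
by apply: (sums_to_eq (coef_sum y)) => i _; rewrite h.
Qed.

Lemma coef_lin c x y i : co (c *: x + y) i = c * co x i + co y i.
Proof.
have [Di|nDi] := pselect (D i); last by rewrite !coef_out // mulr0 addr0.
apply: (@coef_uniq (fun i => c * co x i + co y i)) => //.
apply: (sums_to_eq (sums_toZD c (coef_sum x) (coef_sum y))) => j _.
by rewrite scalerDl scalerA.
Qed.

Lemma coef0 i : co 0 i = 0.
Proof. by have := coef_lin (-1) 0 0 i; rewrite scaler0 addr0 mulN1r addNr. Qed.

Lemma coefD x y i : co (x + y) i = co x i + co y i.
Proof. by have := coef_lin 1 x y i; rewrite scale1r mul1r. Qed.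

Lemma coefZ c x i : co (c *: x) i = c * co x i.
Proof. by have := coef_lin c x 0 i; rewrite addr0 coef0 addr0. Qed.

Lemma coefN x i : co (- x) i = - co x i.
Proof. by rewrite -scaleN1r coefZ mulN1r. Qed.

Lemma coefB x y i : co (x - y) i = co x i - co y i.
Proof. by rewrite coefD coefN. Qed.

Lemma coef_bigsum (S : set nat) (u : nat -> X) n m i :
  co (\sum_(n <= j < m | j \in S) u j) i =
  \sum_(n <= j < m | j \in S) co (u j) i.
Proof.
by apply: (big_morph (fun x => co x i)) => [x y|]; rewrite ?coefD ?coef0.
Qed.

Lemma coef_e i j : D i -> co (e i) j = (i == j)%:R.
Proof.
move=> Di; have [Dj|nDj] := pselect (D j); last first.
  by rewrite coef_out //; case: eqP => // E; rewrite -E in nDj.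
apply: (@coef_uniq (fun j => (i == j)%:R)) => //.
have := sums_to1 (fun j => (i == j)%:R *: e j) Di.
rewrite eqxx scale1r; apply => k _ ki.
by case: eqP => [E|_]; [rewrite E in ki|rewrite scale0r].
Qed.

Lemma rnorm_e i : D i -> rnorm (e i) = 1.
Proof. by have [_ h _] := basis_e => /h; rewrite /rnorm => ->. Qed.

Lemma rnorm_coef x y : (forall i, rnorm (co x i) = rnorm (co y i)) ->
  rnorm x = rnorm y.
Proof.
move=> h; have [_ _ habs] := basis_e.
have [z hz xz] := habs _ _ (coef_sum x).
have [z' hz' yz'] := habs _ _ (coef_sum y).
rewrite /rnorm xz yz'; congr (complex.Re `|_|); apply: sums_to_uniq hz _.
apply: (sums_to_eq hz') => i _.
by rewrite (@rnorm_inj _ _ _ (co y i) (co x i)).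
Qed.

(** Flipping the signs of the deleted coordinates does not change the norm, and
    the truncated vector is the midpoint of the two. *)
Lemma rnorm_part y x : (forall i, co y i = co x i \/ co y i = 0) ->
  rnorm y <= rnorm x.
Proof.
move=> h.
have E : rnorm (2 *: y - x) = rnorm x.
  apply: rnorm_coef => i; rewrite coefB coefZ.
  by case: (h i) => ->; [congr rnorm; ring|rewrite mulr0 sub0r rnormN].
have : rnorm (2 *: y) <= rnorm x + rnorm x.
  by have := rnormD (2 *: y - x) x; rewrite subrK E.
rewrite rnormZ (_ : 2 = 2%:C) ?rnormR ?ger0_norm //; last by rewrite rmorph_nat.
by move=> ?; lra.
Qed.

(** For |a| <= |b| the left vector is, up to a phase, a convex combination of
    [b *: e i + x] and [- b *: e i + x], which have the same norm. *)
Lemma rnorm_add_mono x (a b : R[i]) i : D i -> co x i = 0 ->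
  rnorm a <= rnorm b -> rnorm (a *: e i + x) <= rnorm (b *: e i + x).
Proof.
move=> Di xi ab; have [b0|b0] := eqVneq (rnorm b) 0.
  have a0 : rnorm a = 0 by apply/le_anti; rewrite rnorm_ge0 -b0 ab.
  by rewrite (rnorm0_eq0 a0) (rnorm0_eq0 b0).
have bgt : 0 < rnorm b by rewrite lt_neqAle eq_sym b0 rnorm_ge0.
pose t := rnorm a / rnorm b.
have t0 : 0 <= t by rewrite divr_ge0 ?rnorm_ge0.
have t1 : t <= 1 by rewrite ler_pdivrMr // mul1r.
have E c : rnorm c = rnorm b -> rnorm (c *: e i + x) = rnorm (b *: e i + x).
  move=> cb; apply: rnorm_coef => j; rewrite !coefD !coefZ coef_e //.
  by case: eqP => [<-|_]; rewrite ?xi ?mulr1 ?mulr0 ?addr0.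
have -> : rnorm (a *: e i + x) = rnorm ((t%:C * b) *: e i + x).
  apply: rnorm_coef => j; rewrite !coefD !coefZ coef_e //.
  case: eqP => [<-|_]; rewrite ?xi ?mulr1 ?mulr0 ?addr0 //.
  by rewrite rnormM rnormR ger0_norm // divfK.
have -> : (t%:C * b) *: e i + x = ((1 + t) / 2)%:C *: (b *: e i + x) +
    ((1 - t) / 2)%:C *: ((- b) *: e i + x).
  rewrite !scalerDr addrACA !scalerA -!scalerDl mulrN -mulrBl -rmorphB -rmorphD.
  have -> : (1 + t) / 2 - (1 - t) / 2 = t by field.
  by have -> : (1 + t) / 2 + (1 - t) / 2 = 1; [field|rewrite scale1r].
apply: le_trans (rnormD _ _) _; rewrite !rnormZ !rnormR (E (- b)) ?rnormN //.
rewrite !ger0_norm; [|lra|lra].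
by set N := rnorm _; lra.
Qed.

Lemma rnorm_coef_le x i : rnorm (co x i) <= rnorm x.
Proof.
have [Di|nDi] := pselect (D i); last by rewrite coef_out // rnorm0 rnorm_ge0.
have -> : rnorm (co x i) = rnorm (co x i *: e i).
  by rewrite rnormZ rnorm_e // mulr1.
apply: rnorm_part => j; rewrite coefZ coef_e //.
by case: eqP => [<-|_]; rewrite ?mulr1 ?mulr0; [left|right].
Qed.

Lemma coef_bigsum_basis (S : set nat) (a : nat -> R[i]) n m i : S `<=` D ->
  co (\sum_(n <= j < m | j \in S) a j *: e j) i =
  if (i \in S) && (n <= i < m)%N then a i else 0.
Proof.
move=> SD; rewrite coef_bigsum.
have -> : \sum_(n <= j < m | j \in S) co (a j *: e j) i =
   \sum_(n <= j < m | (j \in S) && (j == i)) a i.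
  rewrite [RHS]big_mkcondr /=; apply: eq_bigr => j /set_mem /SD Dj.
  by rewrite coefZ coef_e //; case: eqP => [->|]; rewrite ?mulr1 ?mulr0.
have [/andP[iS /andP[ni im]]|/negP h] := ifPn.
  have z k l : (l <= i)%N || (i < k)%N ->
      \sum_(k <= j < l | (j \in S) && (j == i)) a i = 0.
    move=> kl; rewrite big_nat_cond big1 // => j /andP[/andP[kj jl]].
    by case/andP=> _ /eqP E; move: kl kj jl; rewrite E; lia.
  rewrite (big_cat_nat ni (ltnW im)) /= z ?leqnn // add0r.
  by rewrite big_ltn_cond // iS eqxx /= z ?addr0 // ltnS leqnn orbT.
rewrite big_nat_cond big1 // => j /andP[nj /andP[jS /eqP E]].
by case: h; rewrite -E jS.
Qed.

Lemma coef_sums (S : set nat) (a : nat -> R[i]) x i : S `<=` D ->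
  sums_to S (fun j => a j *: e j) x -> co x i = if i \in S then a i else 0.
Proof.
move=> SD h; have [Di|nDi] := pselect (D i); last first.
  by rewrite coef_out //; case: ifPn => // /set_mem /SD.
apply: (@coef_uniq (fun i => if i \in S then a i else 0)) => //.
apply/(@sums_to_sub _ _ D S) => //.
  by move=> j _ nS; rewrite memNset // scale0r.
by apply: (sums_to_eq h) => j Sj; rewrite mem_set.
Qed.

Lemma sums_coef (S : set nat) x : S `<=` D -> XS S x ->
  sums_to S (fun j => co x j *: e j) x.
Proof.
move=> SD h; apply/(sums_to_sub _ SD); last exact: coef_sum.
by move=> i _ /h ->; rewrite scale0r.
Qed.

(** Coordinates are continuous, so they can be read off the summands. *)
Lemma coef_of_sum (M : set nat) (u : nat -> X) y i j : M j ->
  sums_to M u y -> (forall l, M l -> l <> j -> co (u l) i = 0) ->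
  co y i = co (u j) i.
Proof.
move=> Mj /sums_toP hy hu; apply/eqP; rewrite -subr_eq0; apply/eqP.
apply: rnorm_small_eq0 => eps e0; have [N hN] := hy _ e0.
have := hN _ (leq_maxl N j.+1); set n := maxn _ _.
have -> : co (u j) i = co (\sum_(0 <= l < n | l \in M) u l) i.
  rewrite coef_bigsum; have jn : (j < n)%N by rewrite leq_max leqnn orbT.
  have z k k' : (forall l, (k <= l < k')%N -> l <> j) ->
      \sum_(k <= l < k' | l \in M) co (u l) i = 0.
    move=> h; rewrite big_nat_cond big1 // => l /andP[kl /set_mem Ml].
    by apply: hu => //; exact: h.
  rewrite (big_cat_nat (leq0n j) (ltnW jn)) /= z => [|l]; last by lia.
  rewrite add0r big_ltn_cond // mem_set // z ?addr0 //.
  by move=> l /andP[jl _] E; rewrite E ltnn in jl.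
by rewrite -coefB => h; apply: le_trans (rnorm_coef_le _ _) (ltW h).
Qed.

(** Coordinate projections onto arbitrary sets of indices exist because
    truncations of Cauchy sums are Cauchy. *)
Lemma coord_decomposition (S : set nat) x :
  exists y z, [/\ x = y + z, XS S y & XS (~` S) z].
Proof.
pose a i := if i \in S then co x i else 0.
have [y hy] : exists y, sums_to D (fun i => a i *: e i) y.
  apply: sums_to_cauchy => eps e0.
  have /sums_toP/(_ _ (divr_gt0 e0 (ltr0n _ 2)))[N hN] := coef_sum x.
  exists N => n m Nn nm.
  apply: (@le_lt_trans _ _
    (rnorm (\sum_(n <= i < m | i \in D) co x i *: e i))).
    apply: rnorm_part => i; rewrite !coef_bigsum_basis // /a.
    by case: (_ && _); [case: ifP; [left|right]|left].
  have -> : \sum_(n <= i < m | i \in D) co x i *: e i =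
     (x - \sum_(0 <= i < n | i \in D) co x i *: e i)
     - (x - \sum_(0 <= i < m | i \in D) co x i *: e i).
    rewrite (big_cat_nat (leq0n n) nm) /= opprB [RHS]addrC subrKA.
    by rewrite addrAC subrr add0r.
  apply: (le_lt_trans (rnormB _ _)).
  have := hN _ Nn; have := hN _ (leq_trans Nn nm); lra.
have cy i : co y i = a i.
  have [Di|nDi] := pselect (D i); first exact: (coef_uniq hy Di).
  by rewrite /a !coef_out //; case: ifP.
exists y, (x - y); split=> [|i nS|i nnS]; first by rewrite addrC subrK.
  by rewrite cy /a memNset.
by rewrite coefB cy /a mem_set ?subrr //; exact: contrapT.
Qed.

Lemma coord_subspace_e (S : set nat) i : D i -> S i -> XS S (e i).
Proof.
by move=> Di Si j nSj; rewrite coef_e //; case: eqP => // E; rewrite -E in nSj.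
Qed.

Lemma coord_subspace_lin (S : set nat) c x y :
  XS S x -> XS S y -> XS S (c *: x + y).
Proof. by move=> hx hy i nS; rewrite coef_lin hx // hy // mulr0 addr0. Qed.

Lemma coord_subspace0 (S : set nat) : XS S 0.
Proof. by move=> i _; rewrite coef0. Qed.

Lemma coord_subspaceZ (S : set nat) c x : XS S x -> XS S (c *: x).
Proof. by move=> hx i nS; rewrite coefZ hx // mulr0. Qed.

Lemma coord_subspaceD (S : set nat) x y : XS S x -> XS S y -> XS S (x + y).
Proof. by move=> hx hy i nS; rewrite coefD hx // hy // addr0. Qed.

Lemma coord_subspace_sub (S S' : set nat) x : S `<=` S' -> XS S x -> XS S' x.
Proof. by move=> SS' hx i nS'; apply: hx => /SS'. Qed.

(** Coordinates are contractions, hence their kernels are closed. *)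
Lemma closed_spanE (S : set nat) : S `<=` D -> closed_span S e = XS S.
Proof.
move=> SD; apply/seteqP; split=> x.
  move=> hx i nS; apply: rnorm_small_eq0 => eps e0.
  have /hx[_ [[[n a] _ <-] /=]] : nbhs x (ball x eps%:C).
    by apply: nbhsx_ballx; rewrite ltcR.
  rewrite -ball_normE /= rnormE ltcR => h.
  have := coef_bigsum_basis a 0 n i SD; rewrite memNset //= => E.
  rewrite -(subr0 (co x i)) -E -coefB.
  exact: le_trans (rnorm_coef_le _ _) (ltW h).
move=> /(sums_coef SD) hx B /hx[N _ /(_ N (leqnn N))] /= hB.
exists (\sum_(0 <= i < N | i \in S) co x i *: e i); split=> //.
by exists (N, co x).
Qed.

End Coordinates.
Arguments coef_sum {R X D e} basis_e x.
Arguments sums_coef : clear implicits.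
Arguments sums_coef {R X D e} basis_e {S x}.

(** * Hermitian operators obtained from an isometry *)

Section Isometries.
Variables (R : realType) (X : completeNormedModType R[i]).
Variables (D : set nat) (e : nat -> X).
Hypothesis basis_e : normalized_unconditional_basis D e.
Local Notation co := (coef D e).
Local Notation XS := (coord_subspace D e).
Implicit Types (x y z : X) (c : R[i]) (L T : X -> X) (s : R).

Definition linear_map L := forall c x y, L (c *: x + y) = c *: L x + L y.

(** A surjective linear isometry with its inverse: the arguments below are
    symmetric in the two. *)
Definition isometry_pair T T' :=
  [/\ linear_map T, linear_map T', cancel T T', cancel T' T
    & forall x, rnorm (T x) = rnorm x].

Lemma isometry_pair_sym T T' : isometry_pair T T' -> isometry_pair T' T.
Proof. by case=> lT lT' TK T'K nT; split=> // x; rewrite -nT T'K. Qed.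

Lemma linear_map0 L : linear_map L -> L 0 = 0.
Proof.
by move=> lL; have := lL (-1) 0 0; rewrite scaler0 addr0 scaleN1r addNr.
Qed.

Lemma linear_mapD L (lL : linear_map L) x y : L (x + y) = L x + L y.
Proof. by have := lL 1 x y; rewrite !scale1r. Qed.

Lemma linear_mapZ L (lL : linear_map L) c x : L (c *: x) = c *: L x.
Proof. by have := lL c x 0; rewrite (linear_map0 lL) !addr0. Qed.

Lemma linear_mapB L (lL : linear_map L) x y : L (x - y) = L x - L y.
Proof. by rewrite (linear_mapD lL) -scaleN1r (linear_mapZ lL) scaleN1r. Qed.

Lemma linear_map_sum L (lL : linear_map L) (S : set nat) (u : nat -> X) n m :
  L (\sum_(n <= j < m | j \in S) u j) = \sum_(n <= j < m | j \in S) L (u j).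
Proof.
apply: (big_morph L) => [x y|]; [exact: linear_mapD|exact: linear_map0].
Qed.

(** A coordinate of the image is determined by the images of the basis vectors,
    since coordinates are continuous. *)
Lemma coef_image_eq0 L x b : linear_map L -> (forall z, rnorm (L z) = rnorm z) ->
  (forall i, D i -> co x i <> 0 -> co (L (e i)) b = 0) -> co (L x) b = 0.
Proof.
move=> lL nL h; apply: rnorm_small_eq0 => eps e0.
have /sums_toP/(_ _ e0)[N hN] := coef_sum basis_e x.
set y := \sum_(0 <= i < N | i \in D) co x i *: e i.
have -> : co (L x) b = co (L (x - y)) b.
  rewrite (linear_mapB lL) (coefB basis_e) [X in _ - X](_ : _ = 0) ?subr0 //.
  rewrite (linear_map_sum lL) (coef_bigsum basis_e) big1 // => i /set_mem Di.
  rewrite (linear_mapZ lL) (coefZ basis_e).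
  have [->|/eqP xi] := eqVneq (co x i) 0; first by rewrite mul0r.
  by rewrite h // mulr0.
apply: le_trans (rnorm_coef_le basis_e _ _) _.
by rewrite nL; exact: ltW (hN _ (leqnn N)).
Qed.

(** The inequality satisfied, by Taylor expansion of [exp (i s H)], by a
    hermitian operator H of norm at most 1. *)
Definition hermitian (H : X -> X) := forall s x,
  rnorm (x + (s%:C * 'i%C) *: H x) <= (1 + s ^+ 2 / 2) * rnorm x.

(** [1 + i s (H - H') / 2] is the mean of [1 + i s H] and [1 - i s H']. *)
Lemma hermitian_half_sub (H H' : X -> X) : hermitian H -> hermitian H' ->
  hermitian (fun x => 2^-1 *: (H x - H' x)).
Proof.
move=> h h' s x.
have -> : x + (s%:C * 'i%C) *: (2^-1 *: (H x - H' x)) =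
  (2^-1)%:C *: ((x + (s%:C * 'i%C) *: H x) + (x + ((- s)%:C * 'i%C) *: H' x)).
  have half : (2^-1)%:C = 2^-1 :> R[i] by rewrite fmorphV /= rmorph_nat.
  have xE : x = 2^-1 *: (x + x).
    by rewrite -mulr2n -[x *+ 2]scaler_nat scalerA mulVf ?scale1r ?pnatr_eq0.
  rewrite half addrACA rmorphN mulNr scaleNr -scalerBr [RHS]scalerDr -xE.
  by rewrite !scalerA mulrC.
rewrite rnormZ rnormR ger0_norm ?invr_ge0 ?ler0n //.
have := rnormD (x + (s%:C * 'i%C) *: H x) (x + ((- s)%:C * 'i%C) *: H' x).
have := h s x; have := h' (- s) x; rewrite sqrrN; lra.
Qed.

(** Multiplication of the coordinate a by w; an isometry when |w| = 1. *)
Definition phase (w : R[i]) (a : nat) x := x + ((w - 1) * co x a) *: e a.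

Lemma coef_phase w a x i : D a ->
  co (phase w a x) i = if a == i then w * co x a else co x i.
Proof.
move=> Da; rewrite (coefD basis_e) (coefZ basis_e) (coef_e basis_e) //.
by case: eqP => [->|_]; rewrite /= ?mulr1n ?mulr0n; ring.
Qed.

Lemma rnorm_phase w a x : D a -> rnorm w = 1 -> rnorm (phase w a x) = rnorm x.
Proof.
move=> Da w1; apply: (rnorm_coef basis_e) => i; rewrite coef_phase //.
by case: eqP => [->|//]; rewrite rnormM w1 mul1r.
Qed.

Lemma linear_phase w a : linear_map (phase w a).
Proof.
move=> c x y; rewrite /phase (coef_lin basis_e) mulrDr scalerDl scalerDr scalerA.
by rewrite mulrCA addrACA.
Qed.

Lemma phaseK w w' a : D a -> w * w' = 1 -> cancel (phase w' a) (phase w a).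
Proof.
move=> Da ww x; apply: (coef_inj basis_e) => i; rewrite !coef_phase // eqxx.
by case: eqP => // <-; rewrite mulrA ww mul1r.
Qed.

Lemma hermitian_phase w w' a (H : X -> X) : D a -> w * w' = 1 -> rnorm w = 1 ->
  hermitian H -> hermitian (phase w a \o H \o phase w' a).
Proof.
move=> Da ww w1 h s x /=.
have w'1 : rnorm w' = 1 by have := rnormM w w'; rewrite ww rnorm1 w1 mul1r.
rewrite -[X in rnorm (X + _)](phaseK Da ww) addrC -linear_phase.
rewrite rnorm_phase // addrC -(rnorm_phase x Da w'1); exact: h.
Qed.

(** The Cayley transform [w = (1 + i s / 2) / (1 - i s / 2)] of the real number s
    has modulus 1 and satisfies [w - 1 = i s u], where [u = 1 / (1 - i s / 2)].
    It replaces [exp (i s)], at the cost of an explicit remainder. *)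
Lemma cayley s : exists u : R[i], [/\ rnorm u <= 1,
  rnorm (1 + s%:C * 'i%C * u) = 1 &
  s%:C * 'i%C = s%:C * 'i%C * u + (s ^+ 2 / 2)%:C * u].
Proof.
pose d : R[i] := Complex 1 (- (s / 2)).
have d1 : 1 <= rnorm d.
  rewrite rnormc /= -{1}(sqrtr1 R) ler_wsqrtr // expr1n lerDl; exact: sqr_ge0.
have d0 : d != 0 by apply: contraTneq d1 => ->; rewrite rnorm0 ler10.
exists d^-1; have dV : rnorm d^-1 * rnorm d = 1 by rewrite -rnormM mulVf ?rnorm1.
have E : s%:C * 'i%C = d * (s%:C * 'i%C) * d^-1 by rewrite mulrAC mulfV // mul1r.
split; first by have := rnorm_ge0 d^-1; nra.
  have -> : 1 + s%:C * 'i%C / d = Complex 1 (s / 2) / d.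
    rewrite -{1}(mulfV d0) -mulrDl; congr (_ / _); simpc; congr Complex; lra.
  rewrite rnormM -[RHS]dV mulrC; congr (_ * _).
  by rewrite !rnormc /= sqrrN.
rewrite -mulrDl -[LHS](mulfK d0); congr (_ / _); simpc.
by congr Complex; field.
Qed.

(** The operator is the coordinate projection Q of index c conjugated by T. For
    |w| = 1 the operator [1 + (w - 1) Q] is the isometry [phase w c] conjugated
    by T, and the Cayley transform provides w with [w - 1 = i s + O(s^2)]. *)
Lemma hermitian_conjugate T T' (c : nat) : isometry_pair T T' -> D c ->
  hermitian (fun x => co (T' x) c *: T (e c)).
Proof.
move=> TT' Dc s x; have [lT _ TK T'K nT] := TT'.
have [_ _ _ _ nT'] := isometry_pair_sym TT'.
have [u [u1 w1 ->]] := cayley s; set v := s%:C * 'i%C * u in w1 *.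
rewrite scalerDl addrA; apply: le_trans (rnormD _ _) _.
have -> : x + v *: (co (T' x) c *: T (e c)) = T (phase (1 + v) c (T' x)).
  rewrite /phase (linear_mapD lT) T'K (linear_mapZ lT) -scalerA.
  by congr (_ + _ *: _); rewrite addrC addKr.
rewrite nT rnorm_phase // nT' mulrDl mul1r lerD2l.
rewrite !rnormZ rnormM rnormR ger0_norm ?divr_ge0 ?sqr_ge0 //.
rewrite nT (rnorm_e basis_e) // mulr1 -mulrA ler_wpM2l ?divr_ge0 ?sqr_ge0 //.
apply: le_trans (_ : 1 * rnorm (co (T' x) c) <= _).
  by rewrite ler_wpM2r // rnorm_ge0.
rewrite mul1r -(nT' x); exact: (rnorm_coef_le basis_e).
Qed.

(** From the conjugated projection Q, the operation H |-> (H - S H S) / 2, where S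
    is the sign change of one coordinate, keeps only the entries of H in the row
    and the column of that coordinate, outside the diagonal. Applied for a and
    then for b it leaves the entries (a, b) and (b, a) of Q, which a phase then
    turns by w and its inverse. *)
Lemma hermitian_two_coordinates T T' (a b c : nat) w w' : isometry_pair T T' ->
  D a -> D b -> D c -> a <> b -> w * w' = 1 -> rnorm w = 1 ->
  hermitian (fun x =>
     (w * (co (T (e c)) a * co (T' (e b)) c) * co x b) *: e a +
     (w' * (co (T (e c)) b * co (T' (e a)) c) * co x a) *: e b).
Proof.
move=> TT' Da Db Dc ab ww w1.
have m1 : -1 * -1 = 1 :> R[i] by rewrite mulrNN mulr1.
have n1 : rnorm (-1 : R[i]) = 1 by rewrite rnormN rnorm1.
have h := hermitian_conjugate TT' Dc.
have h1 := hermitian_half_sub h (hermitian_phase Da m1 n1 h).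
have h2 := hermitian_half_sub h1 (hermitian_phase Db m1 n1 h1).
have := hermitian_phase Da ww w1 h2.
set H := _ \o _ => hH s x; have := hH s x; congr (rnorm (_ + _ *: _) <= _).
have [_ lT' _ _ _] := TT'.
have phi d i y : D i -> co (T' (phase d i y)) c =
    co (T' y) c + (d - 1) * co y i * co (T' (e i)) c.
  move=> Di; rewrite /phase (linear_mapD lT') (linear_mapZ lT') (coefD basis_e).
  by rewrite (coefZ basis_e).
apply: (coef_inj basis_e) => i; rewrite /H /=.
have cZ := coefZ basis_e; have cB := coefB basis_e; have cD := coefD basis_e.
have ca v y j : co (phase v a y) j = if a == j then v * co y a else co y j.
  exact: coef_phase.
have cb v y j : co (phase v b y) j = if b == j then v * co y b else co y j.
  exact: coef_phase.
have ce := coef_e basis_e.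
have /negPf ab' : a != b by apply/eqP.
have /negPf ba' : b != a by rewrite eq_sym; apply/eqP.
have [ai|ai] := eqVneq a i; have [bi|bi] := eqVneq b i.
- by rewrite ai bi in ab.
- rewrite -ai !(ca, cb, cZ, cB, cD, phi, ce, eqxx, ab', ba') //=; by field.
- rewrite -bi !(ca, cb, cZ, cB, cD, phi, ce, eqxx, ab', ba') //=; by field.
- rewrite !(ca, cb, cZ, cB, cD, phi, ce, eqxx, ab', ba', negPf ai, negPf bi) //=.
  by field.
Qed.
End Isometries.

(** * Rotations of a coordinate plane *)

Section RealEstimates.
Variable R : realType.
Implicit Types (x u t : R).

Lemma expr1D_bernoulli x n : 0 <= x -> (1 + x) ^+ n * (1 - n%:R * x) <= 1.
Proof.
move=> x0; elim: n => [|n IH]; first by rewrite mul1r mul0r subr0.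
apply: le_trans IH; rewrite exprSr -mulrA ler_wpM2l ?exprn_ge0 ?addr_ge0 //.
rewrite -natr1; have : 0 <= n%:R * x ^+ 2 by rewrite mulr_ge0 ?sqr_ge0.
by have := sqr_ge0 x; nra.
Qed.

(** A function growing by a factor 1 + O(s^2) over any step s does not grow at
    all: cut [0, L] into n steps and let n tend to infinity. *)
Lemma second_order_growth (h : R -> R) (K d L : R) :
  0 < d -> 0 <= K -> 0 <= L -> (forall t, 0 <= h t) ->
  (forall t s, 0 <= t -> 0 <= s <= d -> h (t + s) <= (1 + K * s ^+ 2) * h t) ->
  h L <= h 0.
Proof.
move=> d0 K0 L0 h0 hs; rewrite leNgt; apply/negP => lt.
pose B := L / d + K * L ^+ 2 * h L / (h L - h 0).
have gap : 0 < h L - h 0 by rewrite subr_gt0.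
have B1 : 0 <= L / d by rewrite divr_ge0 // ltW.
have B2 : 0 <= K * L ^+ 2 * h L / (h L - h 0).
  by rewrite !mulr_ge0 ?invr_ge0 ?(ltW gap) ?sqr_ge0.
(* n > B makes the step L / n at most d and the total growth factor at most
   [1 / (1 - K L^2 / n)], which is too small to lead from [h 0] to [h L]. *)
have /archi_boundP : 0 <= B by rewrite addr_ge0.
set n := Num.bound B => Bn.
have n0 : 0 < n%:R :> R by apply: le_lt_trans Bn; rewrite addr_ge0.
pose s := L / n%:R.
have s0 : 0 <= s by rewrite divr_ge0 // ltW.
have sd : s <= d.
  rewrite ler_pdivrMr // mulrC -ler_pdivrMr //; apply: ltW.
  by apply: le_lt_trans Bn; rewrite lerDl.
have step k : h (k%:R * s) <= (1 + K * s ^+ 2) ^+ k * h 0.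
  elim: k => [|k IH]; first by rewrite mul0r mul1r.
  rewrite -natr1 mulrDl mul1r exprS -mulrA.
  apply: le_trans (hs _ _ _ _) _; rewrite ?s0 ?mulr_ge0 //.
  by rewrite ler_wpM2l // addr_ge0 // mulr_ge0 // sqr_ge0.
have := step n; have -> : n%:R * s = L by rewrite mulrC divfK // gt_eqF.
set x := K * s ^+ 2; have x0 : 0 <= x by rewrite mulr_ge0 // sqr_ge0.
have nx : n%:R * x = K * L ^+ 2 / n%:R.
  by rewrite /x /s; field; rewrite gt_eqF.
have lt1 : K * L ^+ 2 * h L < n%:R * (h L - h 0).
  by rewrite -ltr_pdivrMr //; apply: le_lt_trans Bn; rewrite lerDr.
have hL : 0 < h L by apply: le_lt_trans lt.
have c1 : n%:R * x * h L < h L - h 0.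
  by rewrite nx mulrAC ltr_pdivrMr // [_ * n%:R]mulrC.
have := expr1D_bernoulli n x0.
set A := (1 + x) ^+ n; set y := n%:R * x in c1 *.
have A0 : 0 <= A by rewrite exprn_ge0 // addr_ge0.
move=> b1 b2; have := h0 0 => h00.
have y1 : 0 < 1 - y by nra.
nra.
Qed.

Lemma sqr_sin_le u : sin u ^+ 2 <= u ^+ 2.
Proof.
wlog u0 : u / 0 < u => [h|].
  have [/h //|u0|<-] := ltgtP 0 u; last by rewrite sin0.
  by have := h (- u); rewrite sinN !sqrrN oppr_gt0; apply.
have [c _] := @MVT _ sin cos _ _ u0 (fun x _ => is_derive_sin x)
  (continuous_subspaceT (@continuous_sin R)).
rewrite sin0 !subr0 => ->; rewrite exprMn ler_piMl ?sqr_ge0 //.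
Qed.

Lemma sqr_tan_le u : -(2^-1) <= u <= 2^-1 ->
  0 < cos u /\ (sin u / cos u) ^+ 2 <= 2 * u ^+ 2.
Proof.
move=> /andP[u1 u2]; have := @pihalf_ge1 R => p1.
have c0 : 0 < cos u by apply: cos_gt0_pihalf; apply/andP; split; lra.
split=> //; rewrite expr_div_n ler_pdivrMr ?exprn_gt0 // cos2sin2.
have := sqr_sin_le u; have : u ^+ 2 <= 4^-1 by nra.
have := sqr_ge0 (sin u); nra.
Qed.

End RealEstimates.

Section Rotations.
Variables (R : realType) (X : completeNormedModType R[i]).
Variables (D : set nat) (e : nat -> X).
Hypothesis basis_e : normalized_unconditional_basis D e.
Local Notation co := (coef D e).
Implicit Types (x y z : X) (s t : R) (p q w : R[i]) (al be : R[i]).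

(** The rotations of the plane of [e a] and [e b] are isometries of X. The first
    case makes the relation reflexive. *)
Definition same_hilbert_block (a b : nat) := a = b \/
  [/\ a <> b, D a, D b & forall al be y, co y a = 0 -> co y b = 0 ->
    rnorm (al *: e a + be *: e b + y) =
    rnorm ((Num.sqrt (rnorm al ^+ 2 + rnorm be ^+ 2))%:C *: e a + y)].

Section Plane.
Variables (a b : nat).
Hypotheses (Da : D a) (Db : D b) (ab : a <> b).

Definition plane y al be := rnorm (al *: e a + be *: e b + y).

Let eab : (a == b) = false. Proof. by apply/eqP. Qed.
Let eba : (b == a) = false. Proof. by rewrite eq_sym. Qed.

Lemma coef_plane al be y i : co (al *: e a + be *: e b + y) i =
  al * (a == i)%:R + be * (b == i)%:R + co y i.
Proof.
by rewrite !(coefD basis_e, coefZ basis_e) !(coef_e basis_e).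
Qed.

Lemma plane_mono y al be al' be' : co y a = 0 -> co y b = 0 ->
  rnorm al <= rnorm al' -> rnorm be <= rnorm be' ->
  plane y al be <= plane y al' be'.
Proof.
move=> ya yb h h'; rewrite /plane -!addrA.
apply: (@le_trans _ _ (rnorm (al' *: e a + (be *: e b + y)))).
  apply: (rnorm_add_mono basis_e) => //.
  by rewrite (coefD basis_e) (coefZ basis_e) (coef_e basis_e) // eba mulr0 add0r.
rewrite [in leLHS]addrCA [in leRHS]addrCA; apply: (rnorm_add_mono basis_e) => //.
by rewrite (coefD basis_e) (coefZ basis_e) (coef_e basis_e) // eab mulr0 add0r.
Qed.

Lemma plane_norm y al be al' be' : co y a = 0 -> co y b = 0 ->
  rnorm al = rnorm al' -> rnorm be = rnorm be' ->
  plane y al be = plane y al' be'.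
Proof.
by move=> ya yb h h'; apply/le_anti; rewrite !plane_mono ?h ?h'.
Qed.

Lemma plane0_ge al be : rnorm al <= plane 0 al be /\ rnorm be <= plane 0 al be.
Proof.
rewrite /plane; set x := _ + 0.
have := rnorm_coef_le basis_e x a; have := rnorm_coef_le basis_e x b.
rewrite /x !coef_plane !(coef0 basis_e) !eqxx eab eba !mulr0 !mulr1 !addr0 add0r.
by move=> -> ->.
Qed.

Lemma plane0_l al : plane 0 al 0 = rnorm al.
Proof. by rewrite /plane scale0r !addr0 rnormZ (rnorm_e basis_e) // mulr1. Qed.

Lemma plane0_r be : plane 0 0 be = rnorm be.
Proof. by rewrite /plane scale0r add0r addr0 rnormZ (rnorm_e basis_e) // mulr1. Qed.

(** Let p and q be the two entries of a hermitian operator supported by the plane.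
    Its phases are chosen below so that it moves the first coordinate along the
    reals, or along the imaginary axis, at speed P; the other coordinate is then
    moved at speed - r or i r. It is shown that r is real and positive, so that
    the flow runs along an ellipse on which the norm is constant. The unit
    vectors [e a] and [e b] are on a common ellipse only if it is a circle. *)
Variables (p q : R[i]).
Hypothesis p0 : p != 0.
Hypothesis herm_pq : forall w w', w * w' = 1 -> rnorm w = 1 ->
  hermitian (fun x => (w * p * co x b) *: e a + (w' * q * co x a) *: e b).

Let P := rnorm p.
Let r : R[i] := p * q / P%:C.

Let P0 : 0 < P.
Proof.
by rewrite lt_neqAle rnorm_ge0 andbT eq_sym; apply: contraNneq p0 => /rnorm0_eq0 ->.
Qed.

Let PC0 : P%:C != 0 :> R[i].
Proof. by rewrite -(rmorph0 (real_complex R)) (inj_eq (@complexI R)) gt_eqF. Qed.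

Lemma plane_flow w w' y s al be : w * w' = 1 -> rnorm w = 1 ->
  co y a = 0 -> co y b = 0 ->
  plane y (al + s%:C * 'i%C * (w * p * be)) (be + s%:C * 'i%C * (w' * q * al))
    <= (1 + s ^+ 2 / 2) * plane y al be.
Proof.
move=> ww w1 ya yb; have := herm_pq ww w1 s (al *: e a + be *: e b + y).
rewrite !coef_plane !eqxx eab eba ya yb !mulr0 !mulr1 !addr0 add0r.
congr (rnorm _ <= _); rewrite !scalerDl scalerDr !scalerA.
by rewrite addrAC addrACA.
Qed.

Let i0 : 'i%C != 0 :> R[i]. Proof. by rewrite complexiE neq0Ci. Qed.

Let rnormi : rnorm ('i%C : R[i]) = 1.
Proof. by rewrite rnormc /= expr0n add0r expr1n sqrtr1. Qed.

Lemma plane_flow_real y s al be : co y a = 0 -> co y b = 0 ->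
  plane y (al + (s * P)%:C * be) (be - s%:C * r * al)
    <= (1 + s ^+ 2 / 2) * plane y al be.
Proof.
move=> ya yb.
(* The phase w with [i w p = P]. *)
have w1 : rnorm (P%:C / ('i%C * p)) = 1.
  rewrite rnormM rnormcV rnormM rnormi mul1r rnormR ger0_norm ?rnorm_ge0 //.
  by rewrite divff // gt_eqF.
have ww : P%:C / ('i%C * p) * ('i%C * p / P%:C) = 1.
  by field; rewrite p0 PC0 i0.
have := plane_flow s al be ww w1 ya yb; congr (plane _ (_ + _) (_ + _) <= _).
  by rewrite rmorphM; field; rewrite p0 i0.
rewrite /r mulrA [_ * ('i%C * p / _ * q)]mulrC.
have -> : 'i%C * p / P%:C * q * (s%:C * 'i%C) =
   'i%C ^+ 2 * (s%:C * (p * q / P%:C)) by ring.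
by rewrite sqr_i mulN1r mulNr.
Qed.

Lemma plane_flow_imag y s al be : co y a = 0 -> co y b = 0 ->
  plane y (al + s%:C * 'i%C * (P%:C * be)) (be + s%:C * 'i%C * (r * al))
    <= (1 + s ^+ 2 / 2) * plane y al be.
Proof.
move=> ya yb.
(* The phase w with [w p = P]. *)
have w1 : rnorm (P%:C / p) = 1.
  rewrite rnormM rnormcV rnormR ger0_norm ?rnorm_ge0 //.
  by rewrite divff // gt_eqF.
have ww : P%:C / p * (p / P%:C) = 1 by field; rewrite p0 PC0.
have := plane_flow s al be ww w1 ya yb; congr (plane _ (_ + _ * _) (_ + _ * _) <= _).
  by field.
by rewrite /r; field.
Qed.

(** Otherwise the imaginary flow, in the suitable direction, would increase |be|
    at first order while not decreasing |al|, and [plane 0 1 be] would not exceed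
    its value 1 at [be = 0]. *)
Lemma flow_coefficient_real : complex.Im r = 0.
Proof.
apply/eqP/negPn/negP => r0; set d := complex.Im r in r0.
have d0 : 0 < d ^+ 2 by rewrite exprn_even_gt0.
have := @second_order_growth R (fun t => plane 0 1 t%:C) ((2 * d ^+ 2)^-1) 1 2.
rewrite -[X in _ -> _ -> _ -> _ -> _ -> _ <= X]/(plane 0 1 0) plane0_l rnorm1.
have := (plane0_ge 1 2%:C).2; rewrite rnormR ger0_norm // => h2 h.
suff : plane 0 1 2%:C <= 1 by move=> h1; have := le_trans h2 h1; lra.
apply: h => // [||t s t0 /andP[s0 _]].
- by rewrite invr_ge0 mulr_ge0 // ltW.
- by move=> t; rewrite rnorm_ge0.
have := @plane_flow_imag 0 (- s / d) 1 t%:C (coef0 basis_e a) (coef0 basis_e b).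
have -> : 1 + (- s / d) ^+ 2 / 2 = 1 + (2 * d ^+ 2)^-1 * s ^+ 2 by field.
apply: le_trans; apply: plane_mono; rewrite ?(coef0 basis_e) //.
  rewrite rnorm1; apply: le_trans (Re_le_rnorm _).
  by rewrite le_eqVlt; apply/orP; left; apply/eqP; simpc.
rewrite rnormR ger0_norm ?addr_ge0 //; apply: le_trans (Re_le_rnorm _).
have reE (u v : R) : complex.Re (t%:C + u%:C * 'i%C * (v%:C + 'i%C * d%:C)) =
    t - u * d by rewrite /=; ring.
by rewrite mulr1 [r]complexE -/d reE mulNr mulNr divfK // opprK.
Qed.

(** Otherwise the real flow would increase |al| at first order while not
    decreasing |be|. *)
Lemma flow_coefficient_pos : 0 < complex.Re r.
Proof.
rewrite ltNge; apply/negP => r0; set d := complex.Re r in r0.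
have rE : r = d%:C by rewrite [r]complexE flow_coefficient_real mulr0 addr0.
have := @second_order_growth R (fun t => plane 0 t%:C 1) ((2 * P ^+ 2)^-1) 1 2.
rewrite -[X in _ -> _ -> _ -> _ -> _ -> _ <= X]/(plane 0 0 1) plane0_r rnorm1.
have := (plane0_ge 2%:C 1).1; rewrite rnormR ger0_norm // => h2 h.
suff : plane 0 2%:C 1 <= 1 by move=> h1; have := le_trans h2 h1; lra.
apply: h => // [||t s t0 /andP[s0 _]].
- by rewrite invr_ge0 mulr_ge0 // sqr_ge0.
- by move=> t; rewrite rnorm_ge0.
have := @plane_flow_real 0 (s / P) t%:C 1 (coef0 basis_e a) (coef0 basis_e b).
have -> : 1 + (s / P) ^+ 2 / 2 = 1 + (2 * P ^+ 2)^-1 * s ^+ 2.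
  by field; rewrite gt_eqF.
apply: le_trans; apply: plane_mono; rewrite ?(coef0 basis_e) //.
  by rewrite divfK ?gt_eqF // mulr1 -rmorphD.
rewrite rnorm1 rE -!rmorphM -(rmorph1 (real_complex R)) -rmorphB rnormR.
apply: le_trans (ler_norm _); rewrite lerBrDr gerDl.
by rewrite mulrAC mulr_ge0_le0 // mulr_ge0 // divr_ge0 // ltW.
Qed.

Let rr := complex.Re r.
Let sP := Num.sqrt P.
Let sr := Num.sqrt rr.

Let sP2 : sP ^+ 2 = P. Proof. by rewrite sqr_sqrtr // ltW. Qed.

Let sr2 : sr ^+ 2 = rr.
Proof. by rewrite sqr_sqrtr // ltW // flow_coefficient_pos. Qed.

Let sP0 : 0 < sP. Proof. by rewrite sqrtr_gt0. Qed.

Let sr0 : 0 < sr. Proof. by rewrite sqrtr_gt0 flow_coefficient_pos. Qed.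

(** A step of the real flow of length [tan u / (sP * sr)], followed by the
    multiplication of the plane by [cos u], is exactly the rotation by u along the
    ellipse. Monotonicity of the norm in the two moduli allows dropping the factor
    [cos u] even though y is not multiplied by it. *)
Lemma plane_arc_step y rho t u : co y a = 0 -> co y b = 0 ->
  -(2^-1) <= u <= 2^-1 ->
  plane y (rho * sP * sin (t + u))%:C (rho * sr * cos (t + u))%:C <=
  (1 + (sP * sr) ^- 2 * u ^+ 2) *
    plane y (rho * sP * sin t)%:C (rho * sr * cos t)%:C.
Proof.
move=> ya yb /sqr_tan_le[c0 tan_u].
have rE : r = (sr ^+ 2)%:C.
  by rewrite [r]complexE flow_coefficient_real mulr0 addr0 sr2.
pose s := sin u / cos u / (sP * sr).
have := plane_flow_real s (rho * sP * sin t)%:C (rho * sr * cos t)%:C ya yb.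
rewrite rE -!rmorphM -rmorphD -rmorphB -sP2.
have -> : rho * sP * sin t + s * sP ^+ 2 * (rho * sr * cos t) =
    rho * sP * sin (t + u) / cos u.
  by rewrite /s sinD; field; rewrite !gt_eqF.
have -> : rho * sr * cos t - s * sr ^+ 2 * (rho * sP * sin t) =
    rho * sr * cos (t + u) / cos u.
  by rewrite /s cosD; field; rewrite !gt_eqF.
move=> h; apply: (le_trans (le_trans _ h)).
  have cV (v : R) : `|v| <= `|v / cos u|.
    rewrite normrM normfV (gtr0_norm c0) ler_peMr //.
    by rewrite invf_ge1 // cos_le1.
  by apply: plane_mono => //; rewrite !rnormR.
rewrite ler_wpM2r ?rnorm_ge0 // lerD2l /s expr_div_n.
rewrite mulrAC [leLHS]mulrC ler_wpM2l ?invr_ge0 ?sqr_ge0 //.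
by move: tan_u; set v := _ ^+ 2; lra.
Qed.

(** Rotations in both directions do not increase the norm. *)
Lemma plane_arc y rho t t' : co y a = 0 -> co y b = 0 ->
  plane y (rho * sP * sin t)%:C (rho * sr * cos t)%:C =
  plane y (rho * sP * sin t')%:C (rho * sr * cos t')%:C.
Proof.
move=> ya yb.
pose h u := plane y (rho * sP * sin u)%:C (rho * sr * cos u)%:C.
rewrite -!/(h _).
have hle (v l : R) (sg : R) : sg ^+ 2 = 1 -> 0 <= l -> h (v + sg * l) <= h v.
  move=> sg2 l0.
  have := @second_order_growth R (fun u => h (v + sg * u)) ((sP * sr) ^- 2) 2^-1 l.
  rewrite mulr0 addr0; apply => // [|u|u s u0 /andP[s0 s1]].
  - by rewrite invr_ge0 sqr_ge0.
  - exact: rnorm_ge0.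
  have -> : s ^+ 2 = (sg * s) ^+ 2 by rewrite exprMn sg2 mul1r.
  rewrite mulrDr addrA; apply: plane_arc_step => //.
  move/eqP: sg2; rewrite sqrf_eq1 => /orP[] /eqP ->; apply/andP; split; lra.
wlog suff hh : t t' / h t <= h t'.
  by apply/le_anti; rewrite !hh.
have [tt'|/ltW tt'] := leP t t'.
  have := hle t' (t' - t) (-1).
  rewrite (_ : t' + -1 * (t' - t) = t); last by ring.
  by apply; rewrite ?sqrrN ?expr1n // subr_ge0.
have := hle t' (t - t') 1.
rewrite (_ : t' + 1 * (t - t') = t); last by ring.
by apply; rewrite ?expr1n // subr_ge0.
Qed.

Lemma plane_rotation al be y : co y a = 0 -> co y b = 0 ->
  rnorm (al *: e a + be *: e b + y) =
  rnorm ((Num.sqrt (rnorm al ^+ 2 + rnorm be ^+ 2))%:C *: e a + y).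
Proof.
move=> ya yb.
(* [sr *: e b] and [sP *: e a] are the ends of a quarter of the ellipse. *)
have srE : sr = sP.
  have := plane_arc 1 0 (pi / 2) (coef0 basis_e a) (coef0 basis_e b).
  rewrite sin0 cos0 sin_pihalf cos_pihalf !mulr0 !mulr1 !mul1r.
  by rewrite plane0_l plane0_r !rnormR !gtr0_norm.
set n := Num.sqrt _.
have n2 : n ^+ 2 = rnorm al ^+ 2 + rnorm be ^+ 2.
  by rewrite sqr_sqrtr // addr_ge0 // sqr_ge0.
have n_ge0 : 0 <= n by rewrite sqrtr_ge0.
have al0 := rnorm_ge0 al; have be0 := rnorm_ge0 be.
have [n0|n0] := eqVneq n 0.
  have al00 : rnorm al = 0 by move: n2; rewrite n0; nra.
  have be00 : rnorm be = 0 by move: n2; rewrite n0; nra.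
  by rewrite n0 (rnorm0_eq0 al00) (rnorm0_eq0 be00) !scale0r add0r.
have n_gt0 : 0 < n by rewrite lt_neqAle eq_sym n0.
have ben : -1 <= rnorm be / n <= 1.
  rewrite ler_pdivlMr // ler_pdivrMr // mul1r; apply/andP; split; nra.
pose t := acos (rnorm be / n).
have ct : n * cos t = rnorm be by rewrite acosK ?in_itv // mulrC divfK.
have st : n * sin t = rnorm al.
  rewrite sin_acos // -[n in n * _]ger0_norm // -sqrtr_sqr -sqrtrM ?sqr_ge0 //.
  rewrite mulrBr mulr1 -exprMn [n * _]mulrC divfK // n2 addrK.
  by rewrite sqrtr_sqr ger0_norm.
have := plane_arc (n / sP) t (pi / 2) ya yb.
rewrite srE sin_pihalf cos_pihalf mulr0 mulr1 divfK ?gt_eqF // ct st.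
rewrite /plane rmorph0 scale0r addr0 => <-; apply: plane_norm => //.
  by rewrite rnormR ger0_norm.
by rewrite rnormR ger0_norm.
Qed.

End Plane.
End Rotations.

(** * Hilbert blocks and the supports of images of basis vectors *)

Section Blocks.
Variables (R : realType) (X : completeNormedModType R[i]).
Variables (D : set nat) (e : nat -> X).
Hypothesis basis_e : normalized_unconditional_basis D e.
Local Notation co := (coef D e).
Local Notation XS := (coord_subspace D e).
Local Notation block := (same_hilbert_block D e).
Implicit Types (x y z : X) (T : X -> X) (a b c : nat) (S : set nat).

(** The entries (a, b) and (b, a) of the projection of index c conjugated by T
    form a hermitian operator of the plane of a and b; here the first is not 0. *)
Lemma isometry_pair_block T T' a b c : isometry_pair T T' -> D a -> D b -> D c ->
  co (T (e c)) a <> 0 -> co (T' (e b)) c <> 0 -> block a b.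
Proof.
move=> TT' Da Db Dc /eqP ha /eqP hb.
have [->|/eqP ab] := eqVneq a b; first by left.
right; split=> // al be y; apply: (plane_rotation basis_e Da Db ab) => [|w w' ww w1].
  exact: mulf_neq0 ha hb.
exact: (hermitian_two_coordinates basis_e TT' Da Db Dc ab ww w1).
Qed.

Lemma blockxx a : block a a. Proof. by left. Qed.

Lemma block_sym a b : block a b -> block b a.
Proof.
case=> [->|[ab Da Db h]]; first by left.
right; split=> // [|al be y yb ya]; first by move=> ba; exact: ab.
set n := Num.sqrt _.
have := h 0 n%:C y ya yb; rewrite scale0r add0r => ->.
rewrite [X in rnorm (X + _)]addrC h //; congr (rnorm (_%:C *: _ + _)).
rewrite rnorm0 expr0n add0r rnormR real_normK ?num_real //.
by rewrite sqr_sqrtr ?addr_ge0 ?sqr_ge0 // addrC.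
Qed.

(** Both sides are compared with the vector in which the coordinates a, b and c
    are merged. *)
Lemma block_trans a b c : block a b -> block b c -> block a c.
Proof.
move=> /[dup] ab_ [->//|[ab Da Db hab]] [<-//|[bc _ Dc hbc]].
have [->|/eqP ac] := eqVneq a c; first by left.
have hba : forall al be y, co y b = 0 -> co y a = 0 ->
    rnorm (al *: e b + be *: e a + y) =
    rnorm ((Num.sqrt (rnorm al ^+ 2 + rnorm be ^+ 2))%:C *: e b + y).
  by case: (block_sym ab_) => [ba|[]//]; case: ab.
right; split=> // al be y ya yc.
have sq u v : rnorm (Num.sqrt (rnorm u ^+ 2 + rnorm v ^+ 2))%:C ^+ 2 =
    rnorm u ^+ 2 + rnorm v ^+ 2 :> R.
  by rewrite rnormR real_normK ?num_real // sqr_sqrtr // addr_ge0 // sqr_ge0.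
set y' := y - co y b *: e b.
have yE : y = co y b *: e b + y' by rewrite addrC subrK.
have [/eqP ab' /eqP ac' /eqP bc'] : [/\ a <> b, a <> c & b <> c] by [].
have y'0 i : (i == a) || (i == b) || (i == c) -> co y' i = 0.
  rewrite (coefB basis_e) (coefZ basis_e) (coef_e basis_e) //.
  case/orP => [/orP[]|] /eqP ->; rewrite ?eqxx ?ya ?yc ?mulr1 ?subrr //.
    by rewrite eq_sym (negPf ab') mulr0 subrr.
  by rewrite (negPf bc') mulr0 subrr.
rewrite yE; set g := co y b.
have -> : al *: e a + be *: e c + (g *: e b + y') =
   g *: e b + al *: e a + (be *: e c + y').
  by rewrite addrACA [al *: e a + _]addrC.
have zE (d : R[i]) i : (i == a) || (i == b) -> co (d *: e c + y') i = 0.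
  move=> iab; rewrite (coefD basis_e) (coefZ basis_e) (coef_e basis_e) // y'0.
    by case/orP: iab => /eqP ->; rewrite eq_sym ?(negPf ac') ?(negPf bc') mulr0 addr0.
  by rewrite iab.
rewrite hba ?zE ?eqxx ?orbT // addrA hbc ?y'0 ?eqxx ?orbT // sq.
rewrite [X in _ = rnorm X]addrA hab ?y'0 ?eqxx ?orbT // sq.
have -> : forall u : R, rnorm (u%:C *: e b + y') = rnorm (`|u|%:C *: e a + y').
  move=> u; have := hab 0 u%:C y'; rewrite scale0r add0r => ->.
  - by rewrite rnorm0 expr0n add0r rnormR real_normK ?num_real // sqrtr_sqr.
  - by rewrite y'0 // eqxx.
  - by rewrite y'0 // eqxx orbT.
rewrite ger0_norm ?sqrtr_ge0 //; congr (rnorm ((Num.sqrt _)%:C *: _ + _)); ring.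
Qed.

(** The coordinate c of [T' (T (e c)) = e c] is the sum over b of the products of
    these two coordinates. *)
Lemma isometry_pair_support T T' c : isometry_pair T T' -> D c ->
  exists b, [/\ D b, co (T (e c)) b <> 0 & co (T' (e b)) c <> 0].
Proof.
move=> TT' Dc; apply: contrapT => h.
have [_ lT' TK _ _] := TT'; have [_ _ _ _ nT'] := isometry_pair_sym TT'.
suff : co (T' (T (e c))) c = 0.
  by rewrite TK (coef_e basis_e) // eqxx => /eqP; rewrite oner_eq0.
apply: (coef_image_eq0 basis_e) => // b Db hb.
by apply: contrapT => hb'; apply: h; exists b.
Qed.

Lemma coef_neq0 x i : co x i <> 0 -> D i.
Proof. by apply: contra_notP; exact: coef_out. Qed.

(** Every index of the support is in the block of an index b0 provided by
    [isometry_pair_support]. *)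
Lemma support_block T T' b b' c : isometry_pair T T' -> D c ->
  co (T (e c)) b <> 0 -> co (T (e c)) b' <> 0 -> block b b'.
Proof.
move=> TT' Dc hb hb'; have [b0 [Db0 h0 h0']] := isometry_pair_support TT' Dc.
have bb v : co (T (e c)) v <> 0 -> block v b0.
  move=> hv; apply: (isometry_pair_block TT' _ Db0 Dc hv h0').
  exact: coef_neq0 hv.
by apply: block_trans (bb _ hb) _; apply: block_sym; exact: bb.
Qed.

Lemma support_inv_block T T' b c c' : isometry_pair T T' -> D c -> D b ->
  co (T (e c)) b <> 0 -> co (T' (e b)) c' <> 0 -> block c' c.
Proof.
move=> TT' Dc Db hb hc'.
by apply: (isometry_pair_block (isometry_pair_sym TT') _ Dc Db hc' hb);
  exact: coef_neq0 hc'.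
Qed.

Definition image_support T S : set nat :=
  [set b | D b /\ exists2 c, S c & co (T (e c)) b <> 0].

(** For S included in D: a union of blocks. *)
Definition saturated S := forall c c', block c c' -> D c' -> S c -> S c'.

(** For a union S of blocks, T maps the coordinate subspaces of S and of its
    complement onto the coordinate subspaces of [image_support T S] and of its
    complement. *)
Section Saturated.
Variables (T T' : X -> X) (S : set nat).
Hypotheses (TT' : isometry_pair T T') (SD : S `<=` D) (satS : saturated S).
Local Notation F := (image_support T S).

Lemma image_support_sub x : XS S x -> XS F (T x).
Proof.
move=> xS b nFb; have [lT _ _ _ nT] := TT'.
have [Db|] := pselect (D b); last exact: coef_out.
apply: (coef_image_eq0 basis_e) => // i Di xi.
apply: contrapT => hb; apply: nFb; split=> //; exists i => //.
by apply: contrapT => /xS.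
Qed.

Lemma image_support_inv x : XS F x -> XS S (T' x).
Proof.
move=> xF c' nSc'; have [_ lT' _ _ _] := TT'.
have [_ _ _ _ nT'] := isometry_pair_sym TT'.
apply: (coef_image_eq0 basis_e) => // b Db xb; apply: contrapT => hc'.
have [_ [c Sc hb]] : F b by apply: contrapT => /xF.
have := support_inv_block TT' (SD Sc) Db hb hc' => /block_sym bl.
apply: nSc'; apply: satS bl _ Sc; exact: coef_neq0 hc'.
Qed.

Lemma image_support_invC x : XS (~` F) x -> XS (~` S) (T' x).
Proof.
move=> xF c /contrapT Sc; have [_ lT' _ _ _] := TT'.
have TT'_ := isometry_pair_sym TT'; have [_ _ _ _ nT'] := TT'_.
apply: (coef_image_eq0 basis_e) => // b Db xb; apply: contrapT => hc.
have nFb : ~ F b by move=> Fb; apply: xb; exact: xF.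
have [c' [Dc' hc' hb]] := isometry_pair_support TT'_ Db.
apply: nFb; split=> //; exists c' => //; apply: satS Dc' Sc.
exact: (support_block TT'_ Db hc hc').
Qed.

Lemma image_support_sub_dom : F `<=` D. Proof. by move=> b []. Qed.

Lemma image_support_neq0 : S !=set0 -> F !=set0.
Proof.
case=> c Sc; have [b [Db hb _]] := isometry_pair_support TT' (SD Sc).
by exists b; split=> //; exists c.
Qed.

Lemma image_support_proper c : D c -> ~ S c -> exists2 b, D b & ~ F b.
Proof.
move=> Dc nSc; have [b [Db _ hb]] := isometry_pair_support TT' Dc.
exists b => // Fb; apply: hb; apply: image_support_inv => //.
exact: (coord_subspace_e basis_e).
Qed.

End Saturated.
End Blocks.

(** * Fibers *)

Section Fibers.
Variables (R : realType) (X : completeNormedModType R[i]).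
Variables (D : set nat) (e : nat -> X).
Hypothesis basis_e : normalized_unconditional_basis D e.
Local Notation co := (coef D e).
Local Notation XS := (coord_subspace D e).
Local Notation block := (same_hilbert_block D e).
Implicit Types (x y z : X) (T : X -> X) (a b c : nat) (S : set nat).

(** For c in S this expresses that S is a fiber with one equation instead of a
    comparison of two vectors: the part x of [x + y] can be replaced with a multiple
    of [e c] of the same norm. *)
Definition norm_reducible S c := forall x y, XS S x -> XS (~` S) y ->
  rnorm (x + y) = rnorm ((rnorm x)%:C *: e c + y).

Lemma fiber_norm_reducible S c : fiber D e S -> S c -> norm_reducible S c.
Proof.
case=> _ [SD _] h Sc x y xS yS; have Dc := SD _ Sc.
have sy : sums_to (D `\` S) (fun i => co y i *: e i) y.
  apply: (sums_coef basis_e) => [i []//|i ni].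
  have [Si|nSi] := pselect (S i); first by apply: yS => /(_ Si).
  by apply: coef_out => Di; apply: ni.
have xcS : XS S ((rnorm x)%:C *: e c).
  by apply: (coord_subspaceZ basis_e); exact: coord_subspace_e.
rewrite /rnorm; congr complex.Re.
apply: (h _ _ _ _ _ _ (sums_coef basis_e SD xS) (sums_coef basis_e SD xcS) sy).
apply: rnorm_inj; rewrite rnormZ (rnorm_e basis_e) // mulr1 rnormR.
by rewrite ger0_norm // rnorm_ge0.
Qed.

Lemma norm_reducible_fiber S c : S c -> S `<` D -> norm_reducible S c ->
  fiber D e S.
Proof.
move=> Sc SD h; split=> //; first by exists c.
move=> a a' b x x' y hx hx' hy xx'; have [SD' _] := SD.
have xS : XS S x by move=> i nSi; rewrite (coef_sums basis_e i SD' hx) memNset.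
have x'S : XS S x'.
  by move=> i nSi; rewrite (coef_sums basis_e i SD' hx') memNset.
have yS : XS (~` S) y.
  move=> i nnSi; rewrite (coef_sums basis_e i _ hy) => [|j []//].
  by rewrite memNset // => -[].
by apply: rnorm_inj; rewrite (h x) // (h x') // /rnorm xx'.
Qed.

(** The part in S is moved to [e c], then the part in S', which now contains it,
    is moved to [e c] as well. *)
Lemma fiberU S S' c : fiber D e S -> fiber D e S' -> S c -> S' c ->
  S `|` S' `<` D -> fiber D e (S `|` S').
Proof.
move=> fS fS' Sc S'c SD; apply: (@norm_reducible_fiber _ c) => //; first by left.
have hS := fiber_norm_reducible fS Sc; have hS' := fiber_norm_reducible fS' S'c.
have Dc : D c by case: fS => _ [+ _] _; exact.
move=> x y xSS' ySS'.
have [x1 [x2 [xE x1S x2S]]] := coord_decomposition basis_e S x.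
have x2S' : XS S' x2.
  move=> i nS'i; have [Si|nSi] := pselect (S i); first by apply: x2S => /(_ Si).
  have : co x i = 0 by apply: xSS' => -[].
  by rewrite xE (coefD basis_e) x1S // add0r.
have key z : XS (~` (S `|` S')) z -> rnorm (x + z) =
    rnorm ((rnorm ((rnorm x1)%:C *: e c + x2))%:C *: e c + z).
  move=> zSS'; rewrite xE -addrA hS //; last first.
    apply: (coord_subspaceD basis_e) => //.
    by apply: coord_subspace_sub zSS' => i ni Si; apply: ni; left.
  rewrite addrA hS' //.
    apply: (coord_subspaceD basis_e) => //.
    by apply: (coord_subspaceZ basis_e); exact: coord_subspace_e.
  by apply: coord_subspace_sub zSS' => i ni S'i; apply: ni; right.
rewrite key //; have := key 0 (@coord_subspace0 _ _ _ _ basis_e _).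
rewrite !addr0 rnormZ (rnorm_e basis_e) // mulr1 rnormR ger0_norm ?rnorm_ge0 //.
by move=> ->.
Qed.

(** Merging the coordinates one after the other shows that the norm of a vector
    depends on its part in a block only through the Euclidean norm of that part,
    which is also its norm in X. *)
Lemma block_norm_reducible S c : S `<=` D -> S c ->
  (forall b, S b -> block c b) -> norm_reducible S c.
Proof.
move=> SD Sc blk x y xS yS; have Dc := SD _ Sc.
pose u n := co x c *: e c + \sum_(0 <= i < n | i \in S `\ c) co x i *: e i.
have step n : exists2 rho : R, 0 <= rho & forall z,
    (forall i, S i -> (i < n)%N || (i == c) -> co z i = 0) ->
    rnorm (u n + z) = rnorm (rho%:C *: e c + z).
  elim: n => [|n [rho rho0 IH]].
    exists (rnorm (co x c)); first exact: rnorm_ge0.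
    move=> z zc; rewrite /u big_geq // addr0.
    apply: (rnorm_coef basis_e) => i.
    rewrite !(coefD basis_e, coefZ basis_e) !(coef_e basis_e) //.
    case: eqP => [<-|_]; last by rewrite !mulr0.
    by rewrite zc ?eqxx ?orbT // !addr0 !mulr1 rnormR ger0_norm // rnorm_ge0.
  have [|] := boolP (n \in S `\ c); last first.
    move=> nS; exists rho => // z hz; rewrite /u big_mkcond big_nat_recr //= ifN //.
    rewrite addr0 -big_mkcond IH // => i Si /orP[i_n|ic]; last first.
      by rewrite hz // ic orbT.
    by rewrite hz // ltnS (ltnW i_n).
  move=> nS; have := nS; rewrite inE => -[Sn nc].
  have /negPf nc' : n != c by apply/eqP.
  have cn : c <> n by move=> E; apply: nc.
  exists (Num.sqrt (rnorm (rho%:C : R[i]) ^+ 2 + rnorm (co x n) ^+ 2)).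
    exact: sqrtr_ge0.
  move=> z hz; rewrite /u big_mkcond big_nat_recr //= nS -big_mkcond /=.
  rewrite addrA -/(u n) -addrA IH; last first.
    move=> i Si hi; rewrite (coefD basis_e) (coefZ basis_e) (coef_e basis_e) //.
      rewrite hz // ?addr0; last first.
        by case/orP: hi => [i_n|->]; rewrite ?orbT // ltnS (ltnW i_n).
      case: eqP => [ni|_]; last by rewrite mulr0.
      by move: hi; rewrite -ni ltnn nc'.
    exact: SD.
  have [//|[_ _ Dn h]] := blk _ Sn.
  by rewrite addrA h // hz // ?ltnSn ?eqxx ?orbT.
have red n : rnorm (u n + y) = rnorm ((rnorm (u n))%:C *: e c + y).
  have [rho rho0 h] := step n; rewrite h => [|i Si _]; last by apply: yS => /(_ Si).
  have := h 0 (fun i _ _ => coef0 basis_e i); rewrite !addr0 => ->.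
  by rewrite rnormZ (rnorm_e basis_e) // mulr1 rnormR ger0_norm.
have x'S : sums_to (S `\ c) (fun i => co x i *: e i) (x - co x c *: e c).
  have S'D : S `\ c `<=` D by move=> i [/SD].
  have xc : XS (S `\ c) (x - co x c *: e c).
    move=> i ni; rewrite (coefB basis_e) (coefZ basis_e) (coef_e basis_e) //.
    case: eqP => [<-|ic]; first by rewrite mulr1 subrr.
    by rewrite mulr0 subr0 xS // => Si; apply: ni; split=> // E; exact: ic.
  apply: (sums_to_eq (sums_coef basis_e S'D xc)) => i [Si ic].
  rewrite (coefB basis_e) (coefZ basis_e) (coef_e basis_e) //.
  by case: eqP => [E|_]; [case: ic|rewrite mulr0 subr0].
apply: rnorm_eq_approx => eps e0.
have /sums_toP/(_ _ e0)[N /(_ N (leqnn N)) hN] := x'S.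
have xu : rnorm (x - u N) < eps by rewrite opprD addrA.
exists (u N + y), ((rnorm (u N))%:C *: e c + y); split=> //.
  by rewrite opprD addrACA subrr addr0.
rewrite opprD addrACA subrr addr0 -scalerBl -rmorphB rnormZ rnormR.
rewrite (rnorm_e basis_e) // mulr1; apply: le_lt_trans xu.
have := rnorm_le_dist x (u N); have := rnorm_le_dist (u N) x.
by rewrite [rnorm (u N - x)]rdistC ler_norml => h1 h2; apply/andP; split; lra.
Qed.

Section MaximalFiberPartition.
Variables (M : set nat) (A : nat -> set nat).
Hypotheses (partA : partition M A D)
  (maxA : forall j, M j -> maximal_fiber D e (A j)).

Lemma partition_sub j : M j -> A j `<=` D.
Proof. by case: partA => <- _ _ Mj i Ai; exists j. Qed.

Lemma partition_cover c : D c -> exists2 j, M j & A j c.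
Proof. by case: partA => <- _ _ [j Mj Ac]; exists j. Qed.

Lemma partition_uniq i j c : M i -> M j -> A i c -> A j c -> i = j.
Proof. by case: partA => _ h _ Mi Mj Ai Aj; apply: h => //; exists c. Qed.

(** A fiber F meeting two parts [A i] and [A j] would have
    [F `|` A i = F `|` A j = D] by maximality, hence [F = D]. *)
Lemma fiber_in_part F : fiber D e F -> exists2 j, M j & F `<=` A j.
Proof.
move=> fF; have [[c Fc] [FD nDF] _] := fF.
have cov j d : M j -> A j d -> F d -> F `<=` A j \/ D `<=` F `|` A j.
  move=> Mj Ad Fd; have [DF|nDF'] := pselect (D `<=` F `|` A j); first by right.
  have [fA mA] := maxA Mj; left=> z Fz.
  rewrite -(mA (F `|` A j)); [by left|apply: (fiberU fF fA Fd Ad)|by right].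
  by split=> // z' [/FD//|]; exact: partition_sub.
have [j Mj Ac] := partition_cover (FD _ Fc); exists j => //.
have [//|DFj] := cov j c Mj Ac Fc => d Fd.
have [i Mi Ad] := partition_cover (FD _ Fd).
have [FAi|DFi] := cov i d Mi Ad Fd.
  by rewrite -(partition_uniq Mi Mj (FAi _ Fc) Ac).
suff ij : i = j by rewrite -ij.
apply: contrapT => ij; apply: nDF => z Dz.
have [//|Ajz] := DFj _ Dz; have [//|Aiz] := DFi _ Dz.
by case: ij; exact: partition_uniq Mi Mj Aiz Ajz.
Qed.

(** A block that is not all of D is a fiber, hence lies in one part. *)
Lemma maximal_fiber_saturated :
  (forall c, D c -> exists2 d, D d & ~ block c d) ->
  forall j, M j -> saturated D e (A j).
Proof.
move=> proper j Mj c c' cc' Dc' Ac.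
have Dc := partition_sub Mj Ac.
have fC : fiber D e [set b | D b /\ block c b].
  apply: (@norm_reducible_fiber _ c).
  - by split=> //; exact: blockxx.
  - split=> [b []//|h]; have [d Dd nd] := proper _ Dc.
    by apply: nd; have [] := h _ Dd.
  - apply: block_norm_reducible; [by move=> b []| |by move=> b []].
    by split=> //; exact: blockxx.
have [i Mi CA] := fiber_in_part fC.
have Aic : A i c by apply: CA; split=> //; exact: blockxx.
by rewrite -(partition_uniq Mi Mj Aic Ac); apply: CA.
Qed.

(** The image of a part is a coordinate subspace whose index set is again a fiber,
    since T preserves the splitting; so it lies in one part. *)
Lemma maximal_fiber_image T T' :
  (forall j, M j -> saturated D e (A j)) -> isometry_pair T T' ->
  forall j, M j -> exists2 i, M i & forall x, XS (A j) x -> XS (A i) (T x).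
Proof.
move=> sat TT' j Mj; have AD := partition_sub Mj; have satj := sat _ Mj.
have [[[c Ac] [_ nDA] _] _] := maxA Mj.
have [_ lT' _ _ _] := TT'; have [_ _ _ _ nT'] := isometry_pair_sym TT'.
have fF : fiber D e (image_support D e T (A j)).
  have [b Fb] := image_support_neq0 basis_e TT' AD (ex_intro _ c Ac).
  apply: (@norm_reducible_fiber _ b) => //.
    split; first exact: image_support_sub_dom.
    move=> DF; have [d Dd nAd] : exists2 d, D d & ~ A j d.
      by apply: contrapT => h; apply: nDA => z Dz; apply: contrapT => nz;
        apply: h; exists z.
    have [b' Db'] := image_support_proper basis_e TT' AD satj Dd nAd.
    by apply; exact: DF.
  move=> x y xF yF; have Db := image_support_sub_dom Fb.
  have fA := (maxA Mj).1.
  have inv := image_support_inv basis_e TT' AD satj.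
  have invC := image_support_invC basis_e TT' satj.
  have cx : XS (image_support D e T (A j)) ((rnorm x)%:C *: e b).
    by apply: (coord_subspaceZ basis_e); exact: coord_subspace_e.
  rewrite -nT' (linear_mapD lT') -[RHS]nT' (linear_mapD lT').
  rewrite (fiber_norm_reducible fA Ac (inv _ xF) (invC _ yF)).
  rewrite (fiber_norm_reducible fA Ac (inv _ cx) (invC _ yF)).
  rewrite !nT' rnormZ (rnorm_e basis_e) // mulr1 rnormR ger0_norm //.
  exact: rnorm_ge0.
have [i Mi Fi] := fiber_in_part fF; exists i => // x xA.
by apply: coord_subspace_sub Fi _; exact: (image_support_sub basis_e TT' xA).
Qed.

(** If D is a single block, then X is a Hilbert space and all the non-empty proper
    subsets of D are fibers, so that the maximal ones are the complements of
    points; these form a partition only if there are two points. *)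
Lemma maximal_fiber_one_block c : D c -> (forall b, D b -> block c b) ->
  exists d, [/\ c <> d, D = [set c; d] &
    exists i j, [/\ M = [set i; j], A i = [set c] & A j = [set d] ]].
Proof.
move=> Dc blk.
have fS S : S !=set0 -> S `<` D -> fiber D e S.
  move=> [a Sa] [SD nDS]; apply: (@norm_reducible_fiber _ a) => //.
  apply: block_norm_reducible => // b Sb.
  apply: (block_trans basis_e (b := c)); last by apply: blk; exact: SD.
  by apply: block_sym => //; apply: blk; exact: SD.
have [i Mi Aic] := partition_cover Dc.
have [[_ [_ nDA] _] _] := maxA Mi.
have [d Dd nAd] : exists2 d, D d & ~ A i d.
  by apply: contrapT => h; apply: nDA => z Dz; apply: contrapT => nz;
    apply: h; exists z.
have [j Mj Ajd] := partition_cover Dd.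
have cd : c <> d by move=> E; apply: nAd; rewrite -E.
have ij : i <> j by move=> E; apply: nAd; rewrite E.
have DE : D = [set c; d].
  apply/seteqP; split=> [z Dz|z [->|->]//]; apply: contrapT => ncd.
  have /fiber_in_part[l Ml Al] : fiber D e [set c; d].
    apply: fS; first by exists c; left.
    by split=> [z' [->|->]//|h]; apply: ncd; exact: h.
  apply: ij; rewrite -(partition_uniq Ml Mi (Al _ (or_introl erefl)) Aic).
  exact: partition_uniq Ml Mj (Al _ (or_intror erefl)) Ajd.
exists d; split=> //; exists i, j; split.
- apply/seteqP; split=> [l Ml|l [->|->]//].
  have [_ _ /(_ _ Ml)[z Alz]] := partA.
  have := partition_sub Ml Alz; rewrite DE => -[] zE; rewrite zE in Alz.
    by left; exact: partition_uniq Ml Mi Alz Aic.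
  by right; exact: partition_uniq Ml Mj Alz Ajd.
- apply/seteqP; split=> [z Az|z ->//].
  by have := partition_sub Mi Az; rewrite DE => -[//|zd]; case: nAd; rewrite -zd.
- apply/seteqP; split=> [z Az|z ->//].
  have := partition_sub Mj Az; rewrite DE => -[zc|//]; case: ij.
  by rewrite zc in Az; exact: partition_uniq Mi Mj Aic Az.
Qed.

End MaximalFiberPartition.
End Fibers.

(** * Decompositions into l_p-sums *)

Section LpNorm.
Variable R : realType.
Local Open Scope ereal_scope.
Implicit Types (f g : nat -> \bar R) (p : \bar R).

(** Only the empty set is negligible for the counting measure. *)
Lemma ae_counting (P : nat -> Prop) :
  {ae (counting : set nat -> \bar R), forall x, P x} <-> forall x, P x.
Proof.
split=> [[N [mN N0 PN]] x|h]; last by apply: nearW.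
apply: contrapT => nPx; have Nx : N x by apply: PN.
move: N0; rewrite /counting; case: ifPn => // /asboolP finN [].
move/eqP; rewrite pnatr_eq0 size_eq0 => /eqP E.
have : x \in finmap.enum_fset (fset_set N).
  by have := in_fset_set finN x; rewrite mem_set.
by rewrite E.
Qed.

Lemma Lnorm_counting_infty_le f (z : \bar R) :
  (Lnorm counting +oo f <= z) <-> forall i, `|f i| <= z.
Proof.
rewrite unlock /Lnorm.
have -> : 0 < (counting : set nat -> \bar R) setT.
  by rewrite /counting ifF //; apply/asboolP; exact: infinite_nat.
split=> [/ess_sup_inf.ess_supP/ae_counting //|h].
by apply/ess_sup_inf.ess_supP/ae_counting.
Qed.

(** The l_p norm is associative: all terms but one can be replaced with their l_p
    norm. *)
Lemma Lnorm_counting_split p f j : 1 <= p -> (forall i, 0 <= f i) ->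
  Lnorm counting p f = Lnorm counting p (fun i =>
    if i == 0%N then f j else if i == 1%N then
      Lnorm counting p (fun i => if i == j then 0 else f i) else 0).
Proof.
move=> p1 f0; set f' := fun i => if i == j then 0 else f i.
set h := fun i => if i == 0%N then _ else _.
case: p p1 @h => [p p1|_|//] h.
  have p0 : (0 < p)%R by rewrite -lte_fin; apply: lt_le_trans p1; rewrite lte_fin.
  rewrite !Lnorm_counting //; congr (_ `^ _).
  have pw0 g i : 0 <= `|g i| `^ p by rewrite poweR_ge0.
  rewrite (@nneseriesD1 _ _ j) //= [RHS](@nneseriesD1 _ _ 0%N) //=.
  rewrite [X in _ = _ + X](@nneseriesD1 _ _ 1%N) //.
  congr (_ + _).
  rewrite [X in _ = _ + X]eseries0 ?adde0; last first.
    move=> i _ /andP[/negPf i0 /negPf i1]; rewrite /h i0 i1 abse0.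
    by rewrite poweR0r // gt_eqF.
  rewrite /h /= gee0_abs ?Lnorm_ge0 // poweR_Lnorm ?gt_eqF //.
  rewrite ge0_integral_count // eseries_mkcond; apply: eq_eseriesr => i _.
  rewrite /f'; have [_|//] := eqVneq i j.
  by rewrite abse0 poweR0r // gt_eqF.
apply/le_anti/andP; split; apply/Lnorm_counting_infty_le => i.
  have [->|ij] := eqVneq i j.
    have /Lnorm_counting_infty_le/(_ 0%N) := lexx (Lnorm counting +oo h).
    by [].
  have /Lnorm_counting_infty_le/(_ 1%N) := lexx (Lnorm counting +oo h).
  rewrite /h /= gee0_abs ?Lnorm_ge0 // => /Lnorm_counting_infty_le/(_ i).
  by rewrite /f' (negPf ij).
have /Lnorm_counting_infty_le hf := lexx (Lnorm counting +oo f).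
rewrite /h; case: ifP => // _; case: ifP => _; last first.
  by rewrite abse0 Lnorm_ge0.
rewrite gee0_abs ?Lnorm_ge0 //; apply/Lnorm_counting_infty_le => l.
by rewrite /f'; case: eqP => // _; rewrite abse0 Lnorm_ge0.
Qed.

Lemma eq_lpnorm (V W : normedZmodType R[i]) p (D : set nat) (u : nat -> V)
    (v : nat -> W) : (forall i, D i -> rnorm (u i) = rnorm (v i)) ->
  lpnorm p D u = lpnorm p D v.
Proof.
move=> uv; apply: eq_Lnorm => i; case: ifPn => // /set_mem Di.
by rewrite uv.
Qed.

Lemma lpnorm_split (V W : normedZmodType R[i]) p (D : set nat) (u : nat -> V)
    (x y : W) j : 1 <= p -> D j -> rnorm x = rnorm (u j) ->
  (rnorm y)%:E = lpnorm p (D `\ j) u ->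
  lpnorm p D u = lpnorm p `I_2 (fun i => if i == 0%N then x else y).
Proof.
move=> p1 Dj xu yu; rewrite /lpnorm (Lnorm_counting_split j) //; last first.
  by move=> i; case: ifP => // _; rewrite lee_fin rnorm_ge0.
apply: eq_Lnorm => -[|[|i]] /=.
- by rewrite !mem_set //= xu.
- rewrite mem_set //= yu; apply: eq_Lnorm => i.
  case: eqP => [->|ij]; first by rewrite memNset // => -[_]; apply.
  have [/set_mem Di|/negP nDi] := boolP (i \in D); first by rewrite mem_set.
  by rewrite memNset // => -[Di _]; apply: nDi; rewrite mem_set.
- by rewrite memNset.
Qed.

Lemma lpnorm_sub (V : normedZmodType R[i]) p (D S : set nat) (u : nat -> V) :
  S `<=` D -> (forall i, D i -> ~ S i -> u i = 0%R) ->
  lpnorm p S u = lpnorm p D u.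
Proof.
move=> SD h; apply: eq_Lnorm => i.
have [Si|nSi] := pselect (S i); first by rewrite !mem_set //; exact: SD.
rewrite memNset //; case: ifPn => // /set_mem Di.
by rewrite h // rnorm0.
Qed.

Lemma lpnorm2_I2 (V : normedZmodType R[i]) (u : nat -> V) :
  lpnorm 2%:E `I_2 u =
  (Num.sqrt (rnorm (u 0%N) ^+ 2 + rnorm (u 1%N) ^+ 2))%:E.
Proof.
rewrite /lpnorm Lnorm_counting // (@nneseriesD1 _ _ 0%N) //=; last first.
  by move=> i _; rewrite poweR_ge0.
rewrite (@nneseriesD1 _ _ 1%N) //=; last by move=> i _; rewrite poweR_ge0.
rewrite eseries0 ?adde0; last first.
  move=> [|[|i]] _ //= _; rewrite memNset //.
  by rewrite abse0 poweR0r // pnatr_eq0.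
have I2 n : (n < 2)%N -> n \in `I_2 by move=> ?; exact/mem_set.
rewrite !I2 // !gee0_abs ?lee_fin ?rnorm_ge0 // !poweR_EFin; congr EFin.
rewrite !powR_mulrn ?rnorm_ge0 //.
by rewrite powR12_sqrt // addr_ge0 // sqr_ge0.
Qed.

End LpNorm.

Section LpSums.
Variables (R : realType) (X X0 : completeNormedModType R[i]).
Variables (D : set nat) (e : nat -> X).
Hypothesis basis_e : normalized_unconditional_basis D e.
Local Notation co := (coef D e).
Local Notation XS := (coord_subspace D e).
Local Notation block := (same_hilbert_block D e).
Implicit Types (x y z : X) (T : X -> X) (a b c : nat) (S F : set nat).
Variable (p : \bar R).
Hypothesis p1 : (1 <= p)%E.

Definition lp_pair x y : \bar R :=
  lpnorm p `I_2 (fun i => if i == 0%N then x else y).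

Lemma eq_lp_pair x x' y y' : rnorm x = rnorm x' -> rnorm y = rnorm y' ->
  lp_pair x y = lp_pair x' y'.
Proof. by move=> xx' yy'; apply: eq_lpnorm => -[|i] _. Qed.

Definition lp_orthogonal F F' := forall x y, XS F x -> XS F' y ->
  (rnorm (x + y))%:E = lp_pair x y.

(** The decomposition may be found in the image of the subspace under an isometry;
    F and F' need a point of D for the summands not to be trivial. *)
Lemma lp_sum_of_two_preimage T T' S F F' : isometry_pair T T' ->
  (forall z, XS S z <-> XS (F `|` F') (T z)) ->
  (exists2 s, D s & F s) -> (exists2 s, D s & F' s) ->
  lp_orthogonal F F' -> lp_sum_of_two p (XS S).
Proof.
move=> TT' hS exF exF' orth; have [lT lT' TK T'K nT] := TT'.
have subm G : submod_closed (mem [set z | XS G (T z)]).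
  split=> [|c x y]; rewrite !inE /=.
    by rewrite (linear_map0 lT); exact: coord_subspace0.
  by rewrite lT; exact: coord_subspace_lin.
have neq0 G : (exists2 s, D s & G s) -> [set z | XS G (T z)] <> [set 0].
  move=> [s Ds Gs] E; have : [set z | XS G (T z)] (T' (e s)).
    by rewrite /= T'K; exact: coord_subspace_e.
  rewrite E => /= /(congr1 T); rewrite T'K (linear_map0 lT) => es0.
  have := coef_e basis_e s Ds; rewrite es0 (coef0 basis_e) eqxx => /eqP.
  by rewrite eq_sym oner_eq0.
exists [set z | XS F (T z)], [set z | XS F' (T z)]; split=> //.
- by split; exact: neq0.
- apply/seteqP; split=> [z /hS Tz|z].
    have [u [v [uv uF vF]]] := coord_decomposition basis_e F (T z).
    exists (T' u); first by rewrite /= T'K.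
    exists (T' v); last by rewrite -(linear_mapD lT') -uv TK.
    rewrite /= T'K => i nF'; have [Fi|nFi] := pselect (F i).
      by apply: vF => /(_ Fi).
    have := coefD basis_e u v i; rewrite -uv uF // add0r => <-.
    by apply: Tz => -[].
  move=> [u /= uF [v vF <-]]; apply/hS; rewrite (linear_mapD lT).
  apply: (coord_subspaceD basis_e).
    by apply: coord_subspace_sub uF => i; left.
  by apply: coord_subspace_sub vF => i; right.
- move=> u v /= uF vF; rewrite -nT (linear_mapD lT) orth //.
  exact: eq_lp_pair.
Qed.

Lemma isometry_pair_id : isometry_pair (@id X) id.
Proof. by split. Qed.

Lemma is_lp_orthogonal S s : is_lp p S e -> S `<=` D -> S s ->
  lp_orthogonal [set s] (S `\ s).
Proof.
move=> lpS SD Ss x y xs yS.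
have S'D : S `\ s `<=` D by move=> i [/SD].
have xyS : XS S (x + y).
  apply: (coord_subspaceD basis_e).
    by apply: coord_subspace_sub xs => i ->.
  by apply: coord_subspace_sub yS => i [].
rewrite (lpS _ _ (sums_coef basis_e SD xyS)).
have Ds := SD _ Ss.
have xE : x = co x s *: e s.
  apply: (coef_inj basis_e) => i; rewrite (coefZ basis_e) (coef_e basis_e) //.
  case: eqP => [<-|si]; rewrite ?mulr1 // mulr0 xs // => E; exact: si.
apply: (lpnorm_split (j := s)) => //.
  rewrite (coefD basis_e) yS => [|[_]]; last exact.
  by rewrite addr0 {1}xE rnormZ (rnorm_e basis_e) // mulr1.
have yS' : XS S y by apply: coord_subspace_sub yS => i [].
rewrite (lpS _ _ (sums_coef basis_e SD yS')).
rewrite -(@lpnorm_sub _ _ _ S (S `\ s)); [|by move=> i []|]; last first.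
  by move=> i Si ni; apply: yS.
apply: eq_lpnorm => i [Si si]; rewrite (coefD basis_e) (xs i) ?add0r //.
Qed.

Variables (M : set nat) (f : nat -> X0) (A : nat -> set nat).
Hypotheses (partA : partition M A D)
  (crossA : cross_product M f (fun j => XS (A j)))
  (lp_f : is_lp p M f)
  (lp_uniq : forall i j, M i -> M j -> is_lp p (A i) e -> is_lp p (A j) e ->
     i = j)
  (indec : forall j, M j -> ~ is_lp p (A j) e ->
     (`I_2 #<= A j)%card /\ ~ lp_sum_of_two p (XS (A j))).

Lemma lpnorm_components xs x : components M (fun j => XS (A j)) x xs ->
  (rnorm x)%:E = lpnorm p M xs.
Proof.
have [_ cr] := crossA; case=> xsA hx.
have [w hw xw] := cr _ xsA _ hx; rewrite /rnorm xw -/(rnorm w) (lp_f hw).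
by apply: eq_lpnorm => j _; rewrite rnorm_norm.
Qed.

Lemma lp_orthogonal_part j : M j -> lp_orthogonal (A j) (~` A j).
Proof.
move=> Mj x y xA yA; have [[ex _] _] := crossA.
have [ys [ysA hy]] := ex y.
have ysj : ys j = 0.
  apply: (coef_inj basis_e) => i; rewrite (coef0 basis_e).
  have [Ai|nAi] := pselect (A j i); last exact: ysA Mj i nAi.
  rewrite -(coef_of_sum basis_e Mj hy (i := i)); first by apply: yA => /(_ Ai).
  move=> l Ml lj; apply: (ysA _ Ml) => Al; apply: lj.
  exact: (partition_uniq partA Ml Mj Al Ai).
(* The components of [x + y]. *)
pose zs l := if l == j then x else ys l.
have zsxy : components M (fun j => XS (A j)) (x + y) zs.
  split=> [l Ml|]; first by rewrite /zs; case: eqP => [->//|_]; exact: ysA.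
  have h1 : sums_to M (fun l => if l == j then x else 0) x.
    have := sums_to1 (fun l => if l == j then x else 0) Mj.
    by rewrite eqxx; apply => l _; case: eqP.
  have := sums_toZD 1 h1 hy; rewrite scale1r => h; apply: (sums_to_eq h) => l _.
  by rewrite /zs; case: eqP => [->|_]; rewrite ?ysj ?scale1r ?scaler0 ?addr0 ?add0r.
rewrite (lpnorm_components zsxy); apply: (lpnorm_split (j := j)) => //.
  by rewrite /zs eqxx.
rewrite (lpnorm_components (conj ysA hy)).
rewrite -(@lpnorm_sub _ _ _ M (M `\ j)); [|by move=> i []|].
  by apply: eq_lpnorm => l [_ lj]; rewrite /zs; case: eqP.
by move=> l Ml nl; have [->//|/eqP lj] := eqVneq l j; case: nl.
Qed.

Lemma two_elements S : (`I_2 #<= S)%card -> exists a b, [/\ a <> b, S a & S b].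
Proof.
move=> /pcard_leP[g]; have gS n : (n < 2)%N -> S (g n) by move=> n2; exact: funS.
exists (g 0%N), (g 1%N); split; [|exact: gS|exact: gS].
by move=> /(@inj _ _ _ g); rewrite !inE /= => /(_ erefl erefl).
Qed.

(** Let a and a' be in the same block but in different parts. A multiple of [e a']
    is l_p-orthogonal to the part of a, and within a block it can be exchanged
    with the same multiple of [e a]. So the part of a is the l_p-sum of the line
    of [e a] and of the rest. This also holds for the part of a', and one of the
    two parts is indecomposable. *)
Lemma lp_saturated j : M j -> saturated D e (A j).
Proof.
move=> Mj c c' cc' Dc' Ac.
have Dc := partition_sub partA Mj Ac.
have [i Mi Aic'] := partition_cover partA Dc'.
have [<-//|/eqP ij] := eqVneq i j; exfalso.
have cnc' a a' l l' : M l -> M l' -> l <> l' -> A l a -> A l' a' ->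
    block a a' -> ~ is_lp p (A l) e -> False.
  move=> Ml Ml' ll' Aa Aa' aa' nlp.
  have [two ndec] := indec Ml nlp.
  have Da := partition_sub partA Ml Aa; have Da' := partition_sub partA Ml' Aa'.
  have [E|[ana' _ _ rot]] := aa'.
    by apply: ll'; rewrite -E in Aa'; exact: (partition_uniq partA Ml Ml' Aa Aa').
  have nAla' : ~ A l a'.
    by move=> Ala'; apply: ll'; exact: (partition_uniq partA Ml Ml' Ala' Aa').
  apply: ndec; apply: (lp_sum_of_two_preimage (F := A l `\ a) (F' := [set a])
    isometry_pair_id).
  - move=> z; rewrite /= setUC setDUK //.
    by move=> b ->.
  - have [b [b' [bb' Ab Ab']]] := two_elements two.
    have [E|ba] := eqVneq b a.
      exists b'; first exact: (partition_sub partA Ml Ab').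
      by split=> // E'; apply: bb'; rewrite E E'.
    exists b; first exact: (partition_sub partA Ml Ab).
    by split=> //; apply/eqP.
  - by exists a.
  move=> z y zA ya.
  have yE : y = co y a *: e a.
    apply: (coef_inj basis_e) => i0; rewrite (coefZ basis_e) (coef_e basis_e) //.
    case: eqP => [<-|ai]; rewrite ?mulr1 // mulr0 ya // => E; exact: ai.
  have za : co z a = 0 by apply: zA => -[_]; apply.
  have zA' : XS (A l) z by apply: coord_subspace_sub zA => b [].
  have za' : co z a' = 0 by apply: zA'.
  have y'A : XS (~` A l) (co y a *: e a').
    by apply: (coord_subspaceZ basis_e); exact: coord_subspace_e.
  have := lp_orthogonal_part Ml zA' y'A.
  have -> : rnorm (z + co y a *: e a') = rnorm (z + y).
    rewrite [in RHS]yE ![z + _]addrC.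
    have := rot (co y a) 0 z za za'; rewrite scale0r addr0 => ->.
    have := rot 0 (co y a) z za za'; rewrite scale0r add0r => ->.
    by congr (rnorm ((Num.sqrt _)%:C *: _ + _)); rewrite addrC.
  move=> ->; apply: eq_lp_pair => //.
  by rewrite yE (coefZ basis_e) (coef_e basis_e) // eqxx mulr1 !rnormZ !(rnorm_e basis_e).
have [lpj|nlpj] := pselect (is_lp p (A j) e); last first.
  by apply: (cnc' c c' j i) => // ji; apply: ij.
have [lpi|nlpi] := pselect (is_lp p (A i) e); first by apply: ij; exact: lp_uniq.
by apply: (cnc' c' c i j) => //; exact: block_sym.
Qed.

(** Pull the decomposition of X into a part and its complement back by T: it cuts
    the i-th part into two l_p-orthogonal pieces, one of which is empty. *)
Lemma indecomposable_image T T' i : isometry_pair T T' -> M i ->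
  ~ is_lp p (A i) e ->
  exists2 j, M j & forall x, XS (A i) x -> XS (A j) (T x).
Proof.
move=> TT' Mi nlp; have [two ndec] := indec Mi nlp.
have TT'_ := isometry_pair_sym TT'; have [lT _ _ _ nT] := TT'.
have [c [_ [_ Ac _]]] := two_elements two.
have Dc := partition_sub partA Mi Ac.
have [b [Db hb hc]] := isometry_pair_support basis_e TT' Dc.
have [j Mj Ab] := partition_cover partA Db.
have AjD := partition_sub partA Mj; have sat := lp_saturated Mj.
set F := image_support D e T' (A j).
have Fc : F c by split=> //; exists b.
have inv : forall x, XS F x -> XS (A j) (T x).
  exact: (image_support_inv basis_e TT'_ AjD sat).
have invC : forall x, XS (~` F) x -> XS (~` A j) (T x).
  exact: (image_support_invC basis_e TT'_ sat).
have orth : lp_orthogonal F (~` F).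
  move=> x y xF yF; rewrite -nT (linear_mapD lT).
  rewrite (lp_orthogonal_part Mj (inv _ xF) (invC _ yF)).
  by apply: eq_lp_pair; rewrite nT.
exists j => // x xA; apply: inv; apply: coord_subspace_sub xA => d Ad.
apply: contrapT => nFd; apply: ndec.
apply: (lp_sum_of_two_preimage (F := A i `&` F) (F' := A i `\` F) isometry_pair_id).
- by move=> z; rewrite setUIDK.
- by exists c.
- by exists d => //; exact: (partition_sub partA Mi Ad).
move=> u v uF vF; apply: orth; first by apply: coord_subspace_sub uF => z [].
by apply: coord_subspace_sub vF => z [].
Qed.

(** A coordinate subspace of l_p of dimension at least 2 is an l_p-sum of a line
    and of the rest. *)
Lemma indecomposable_image_not_lp T T' i j : isometry_pair T T' -> M i -> M j ->
  ~ is_lp p (A i) e -> (forall x, XS (A i) x -> XS (A j) (T x)) ->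
  ~ is_lp p (A j) e.
Proof.
move=> TT' Mi Mj nlp TA lpj; have [two ndec] := indec Mi nlp.
have [lT _ TK _ _] := TT'.
have [c [c' [cc' Ac Ac']]] := two_elements two.
have AiD := partition_sub partA Mi; have sat := lp_saturated Mi.
have AjD := partition_sub partA Mj.
have Dc := AiD _ Ac; have Dc' := AiD _ Ac'.
set F := image_support D e T (A i).
have FA : F `<=` A j.
  move=> b [Db [a Aa hb]]; apply: contrapT => nAb; apply: hb.
  by apply: (TA _ _ _ nAb); apply: coord_subspace_e => //; exact: AiD.
have TF := image_support_sub basis_e TT' (S := A i).
have [s Fs] := image_support_neq0 basis_e TT' AiD (ex_intro _ c Ac).
have Ds := image_support_sub_dom Fs.
have hF z : XS (A i) z <-> XS F (T z).
  split; first exact: TF.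
  by move=> /(image_support_inv basis_e TT' AiD sat); rewrite TK.
have [[s' [Fs' ss']]|no] := pselect (exists s', F s' /\ s' <> s).
  apply: ndec; apply: (lp_sum_of_two_preimage (F := [set s]) (F' := F `\ s) TT').
  - by move=> z; rewrite setDUK // => ? ->.
  - by exists s.
  - by exists s' => //; exact: image_support_sub_dom Fs'.
  move=> x y xs yF; apply: (is_lp_orthogonal lpj AjD (FA _ Fs)) => //.
  by apply: coord_subspace_sub yF => b [/FA].
have line a : A i a -> T (e a) = co (T (e a)) s *: e s.
  move=> Aa; have /TF h : XS (A i) (e a) by apply: coord_subspace_e => //; exact: AiD.
  apply: (coef_inj basis_e) => l; rewrite (coefZ basis_e) (coef_e basis_e) //.
  case: eqP => [<-|sl]; rewrite ?mulr1 // mulr0 h // => Fl.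
  by apply: no; exists l; split=> // E; exact: sl.
(* Two basis vectors cannot both be mapped into the line of [e s]. *)
set al := co (T (e c)) s; set al' := co (T (e c')) s.
have : T (al' *: e c) = T (al *: e c').
  rewrite !(linear_mapZ lT) line // [in RHS]line // -/al -/al' !scalerA.
  by rewrite mulrC.
move=> /(can_inj TK) /(congr1 (fun x => co x c)).
rewrite !(coefZ basis_e) !(coef_e basis_e) // eqxx mulr1.
have /negPf -> : c' != c by apply/eqP => E; apply: cc'.
rewrite mulr0 => al'0; have := line _ Ac'; rewrite -/al' al'0 scale0r => Tc'0.
have := coef_e basis_e c' Dc'; rewrite -(TK (e c')) Tc'0 -(linear_map0 lT) TK.
by rewrite (coef0 basis_e) eqxx => /eqP; rewrite eq_sym oner_eq0.
Qed.

(** The l_p part cannot reach an indecomposable part i, because T' maps the i-th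
    part into some indecomposable part, from which blocks do not lead out. *)
Lemma lp_image T T' : isometry_pair T T' -> forall j, M j ->
  exists2 i, M i & forall x, XS (A j) x -> XS (A i) (T x).
Proof.
move=> TT' j Mj; have TT'_ := isometry_pair_sym TT'.
have [lp_j|nlp] := pselect (is_lp p (A j) e); last exact: (indecomposable_image TT').
have [lT _ _ _ nT] := TT'; have AjD := partition_sub partA Mj.
exists j => // x xA b nAb.
have [Db|] := pselect (D b); last exact: coef_out.
have [i Mi Ab] := partition_cover partA Db.
apply: (coef_image_eq0 basis_e) => // c Dc xc.
apply: contrapT => hb.
have Ac : A j c by apply: contrapT => /xA.
have ij : i <> j by move=> E; apply: nAb; rewrite -E.
have nlp_i : ~ is_lp p (A i) e by move=> lp_i; apply: ij; exact: lp_uniq.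
have [l Ml TAl] := indecomposable_image TT'_ Mi nlp_i.
have nlp_l := indecomposable_image_not_lp TT'_ Mi Ml nlp_i TAl.
have [c' [Dc' hc' _]] := isometry_pair_support basis_e TT'_ Db.
have Ac' : A l c'.
  apply: contrapT => nAc'; apply: hc'; apply: (TAl _ _ _ nAc').
  exact: coord_subspace_e.
have blk := support_inv_block basis_e TT' Dc Db hb hc'.
have Alc := lp_saturated Ml blk Dc Ac'.
by apply: nlp_l; rewrite (partition_uniq partA Ml Mj Alc Ac).
Qed.

End LpSums.

(** * Isometries of cross products *)

Lemma choice_on (U V : Type) (B : set U) (P : U -> V -> Prop) (v0 : V) :
  (forall u, B u -> exists v, P u v) ->
  exists g : U -> V, forall u, B u -> P u (g u).
Proof.
move=> h; have [u|g hg] := @choice _ _ (fun u v => B u -> P u v); last by exists g.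
by have [/h[v]|] := pselect (B u); [exists v|exists v0].
Qed.

Section CrossProducts.
Variables (R : realType) (X X0 : completeNormedModType R[i]).
Variables (D M : set nat) (e : nat -> X) (f : nat -> X0).
Hypotheses (basis_e : normalized_unconditional_basis D e)
  (basis_f : normalized_unconditional_basis M f).
Variables (A : nat -> set nat) (Y : nat -> set X).
Local Notation co := (coef D e).
Local Notation XS := (coord_subspace D e).
Hypotheses (partA : partition M A D) (YE : forall j, M j -> Y j = XS (A j))
  (crossY : cross_product M f Y).
Implicit Types (x y z : X) (T : X -> X).

Lemma part_subspace0 j : M j -> Y j 0.
Proof. by move=> Mj; rewrite YE //; exact: coord_subspace0. Qed.

Lemma rnorm_interval_abs (a : nat -> R[i]) n m :
  rnorm (\sum_(n <= i < m | i \in M) a i *: f i) =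
  rnorm (\sum_(n <= i < m | i \in M) `|a i| *: f i).
Proof.
apply: (rnorm_coef basis_f) => i; rewrite !(coef_bigsum_basis basis_f) //.
by case: ifP; rewrite ?rnorm_norm.
Qed.

(** The hypothesis on the cross product, which concerns convergent sums, is applied
    to the truncation of the family to the interval. *)
Lemma rnorm_interval_cross xs n m : (forall j, M j -> Y j (xs j)) ->
  rnorm (\sum_(n <= i < m | i \in M) xs i) =
  rnorm (\sum_(n <= i < m | i \in M) `|xs i| *: f i).
Proof.
move=> xsY; have [_ cr] := crossY.
pose ys i := if (n <= i < m)%N then xs i else 0.
have ysY j : M j -> Y j (ys j).
  by move=> Mj; rewrite /ys; case: ifP => _; [exact: xsY|exact: part_subspace0].
have trunc (V : normedModType R[i]) (u v : nat -> V) :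
    (forall i, (n <= i < m)%N -> u i = v i) ->
    (forall i, ~~ (n <= i < m)%N -> v i = 0) ->
    sums_to M v (\sum_(n <= i < m | i \in M) u i).
  move=> uv v0.
  have : sums_to M v (\sum_(0 <= i < m | i \in M) v i).
    by apply: (sums_to_fin m) => i _ mi; apply: v0; lia.
  have -> : \sum_(0 <= i < m | i \in M) v i = \sum_(n <= i < m | i \in M) u i.
    have [nm|mn] := leqP n m; last first.
      rewrite [RHS]big_geq ?(ltnW mn) // big_nat_cond big1 // => i /andP[im _].
      by apply: v0; lia.
    rewrite (big_cat_nat (leq0n n) nm) /= [X in X + _]big_nat_cond big1 ?add0r.
      by rewrite big_nat_cond [RHS]big_nat_cond; apply: eq_bigr => i /andP[/uv].
    by move=> i /andP[im _]; apply: v0; lia.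
  by [].
have hs := trunc _ xs ys.
have [w hw xw] : exists2 w, sums_to M (fun j => `|ys j| *: f j) w &
    `|\sum_(n <= i < m | i \in M) xs i| = `|w|.
  apply: cr ysY _ _; apply: hs => i; rewrite /ys; first by move=> ->.
  by move/negPf => ->.
rewrite /rnorm xw; congr (complex.Re `|_|); apply: sums_to_uniq hw _.
apply: trunc => i; rewrite /ys; first by move=> ->.
by move/negPf => ->; rewrite normr0 scale0r.
Qed.

Lemma rnorm_components x xs : components M Y x xs ->
  exists2 w, sums_to M (fun j => `|xs j| *: f j) w & rnorm x = rnorm w.
Proof.
have [_ cr] := crossY; case=> xsY hx; have [w hw xw] := cr _ xsY _ hx.
by exists w => //; rewrite /rnorm xw.
Qed.

Lemma coef_components x xs j i : components M Y x xs -> M j -> A j i ->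
  co x i = co (xs j) i.
Proof.
move=> [xsY hx] Mj Ai; apply: (coef_of_sum basis_e Mj hx) => l Ml lj.
have := xsY _ Ml; rewrite YE // => xl; apply: xl => Al; apply: lj.
exact: (partition_uniq partA Ml Mj Al Ai).
Qed.

Lemma sums_to_map T T' u x : isometry_pair T T' -> sums_to M u x ->
  sums_to M (T \o u) (T x).
Proof.
move=> [lT _ _ _ nT] /sums_toP h; apply/sums_toP => eps /h[N hN].
by exists N => n /hN; rewrite -(linear_map_sum lT) -(linear_mapB lT) nT.
Qed.

Section PartPermutation.
Hypothesis parts_permuted : forall T T', isometry_pair T T' -> forall j, M j ->
  exists2 i, M i & forall x, XS (A j) x -> XS (A i) (T x).
Variables (T T' : X -> X).
Hypothesis TT' : isometry_pair T T'.

(** The inclusions for T and for T' together say that T maps the subspace of index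
    [pi j] onto the one of index j. *)
Definition part_permutation (pi : nat -> nat) :=
  [/\ set_bij M M pi, forall j, M j -> forall x, Y (pi j) x -> Y j (T x) &
   forall j, M j -> forall x, Y j x -> Y (pi j) (T' x)].

Lemma exists_part_permutation : exists pi, part_permutation pi.
Proof.
have TT'_ := isometry_pair_sym TT'; have [_ _ TK T'K _] := TT'.
have [pi hpi] : exists pi : nat -> nat, forall j, M j -> M (pi j) /\
    forall x, XS (A j) x -> XS (A (pi j)) (T' x).
  apply: (choice_on (P := fun j i => M i /\
    forall x, XS (A j) x -> XS (A i) (T' x)) 0%N) => j Mj.
  by have [i Mi h] := parts_permuted TT'_ Mj; exists i.
have Ae j c : M j -> A j c -> D c /\ XS (A j) (e c).
  move=> Mj Ac; have Dc := partition_sub partA Mj Ac.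
  by split=> //; exact: coord_subspace_e.
have eA j c : D c -> XS (A j) (e c) -> A j c.
  move=> Dc h; apply: contrapT => /h; rewrite (coef_e basis_e) // eqxx.
  by apply/eqP; rewrite oner_eq0.
have ne j : M j -> exists c, A j c by case: partA => _ _ + Mj; move/(_ _ Mj).
have hT j : M j -> forall x, XS (A (pi j)) x -> XS (A j) (T x).
  move=> Mj; have [Mp hp] := hpi _ Mj.
  have [i Mi hi] := parts_permuted TT' Mp.
  have [c Ac] := ne _ Mj; have [Dc ec] := Ae _ _ Mj Ac.
  have := hi _ (hp _ ec); rewrite T'K => /(eA _ _ Dc) Aic.
  by move: hi; rewrite (partition_uniq partA Mi Mj Aic Ac).
exists pi; split; last first.
- by move=> j Mj x; have [Mp hp] := hpi _ Mj; rewrite !YE //; exact: hp.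
- by move=> j Mj x; have [Mp hp] := hpi _ Mj; rewrite !YE //; exact: hT.
split=> [j /hpi[]//|j j' /set_mem Mj /set_mem Mj' pijj'|i Mi].
  have [Mp _] := hpi _ Mj; have [c Ac] := ne _ Mp.
  have [Dc ec] := Ae _ _ Mp Ac.
  have [b [Db hb _]] := isometry_pair_support basis_e TT' Dc.
  have h1 := hT _ Mj _ ec; rewrite pijj' in ec; have h2 := hT _ Mj' _ ec.
  have Ab : A j b by apply: contrapT => /h1.
  have Ab' : A j' b by apply: contrapT => /h2.
  exact: (partition_uniq partA Mj Mj' Ab Ab').
have [j Mj hj] := parts_permuted TT' Mi; exists j => //.
have [Mp hp] := hpi _ Mj; have [c Ac] := ne _ Mi; have [Dc ec] := Ae _ _ Mi Ac.
have := hp _ (hj _ ec); rewrite TK => /(eA _ _ Dc) Ac'.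
exact: (partition_uniq partA Mp Mi Ac' Ac).
Qed.

(** T x is the sum of the same vectors in another order; its components exist and
    are identified by their coordinates, which avoids rearranging a series. *)
Lemma components_image pi x xs : part_permutation pi -> components M Y x xs ->
  components M Y (T x) (fun j => T (xs (pi j))).
Proof.
move=> [[piM pi_inj pi_surj] TY _] /[dup] xxs [xsY hx].
have TxsY j : M j -> Y j (T (xs (pi j))).
  by move=> Mj; apply: TY => //; apply: xsY; exact: piM.
split=> //; have [[ex _] _] := crossY.
have [ys /[dup] Tys [ysY hy]] := ex (T x).
apply: (sums_to_eq hy) => j Mj; apply: (coef_inj basis_e) => b.
have := TxsY _ Mj; have := ysY _ Mj; rewrite YE // => yA TxA.
have [Ab|nAb] := pselect (A j b); last by rewrite yA // TxA.
rewrite -(coef_components Tys Mj Ab).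
apply: (coef_of_sum basis_e (piM _ Mj) (sums_to_map TT' hx)) => l Ml lpi /=.
have [j' Mj' pj'] := pi_surj _ Ml.
have := TxsY _ Mj'; rewrite pj' YE // => TA; apply: TA => Aj'b.
by apply: lpi; rewrite -pj' (partition_uniq partA Mj' Mj Aj'b Ab).
Qed.

(** In X0 a vector with coordinates z has the norm of the sum of the [z j *: u j],
    where u j is a basis vector of X in the j-th part; apply T to that sum. *)
Lemma norm_permutation pi : part_permutation pi -> forall z : nat -> R[i],
  eq_norm_sum M (fun j => z j *: f j) (fun j => z (pi j) *: f j).
Proof.
move=> hpi z x0 hx0; have [[piM _ _] _ _] := hpi.
have [_ _ absf] := basis_f; have [x1 hx1 x01] := absf _ _ hx0.
have [s hs] : exists s : nat -> nat, forall j, M j -> A j (s j).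
  apply: (choice_on (P := fun j c => A j c) 0%N) => j Mj.
  by have [_ _ /(_ _ Mj)[c Ac]] := partA; exists c.
have Ds j : M j -> D (s j) by move=> Mj; exact: (partition_sub partA Mj (hs _ Mj)).
pose xs j := z j *: e (s j).
have xsY j : M j -> Y j (xs j).
  move=> Mj; rewrite YE //; apply: (coord_subspaceZ basis_e).
  by apply: coord_subspace_e; [|exact: Ds|exact: hs].
have nxs j : M j -> `|xs j| = `|z j|.
  by move=> Mj; apply: rnorm_inj; rewrite rnormZ (rnorm_e basis_e) ?mulr1 //; exact: Ds.
have [x hx xx1] : exists2 x, sums_to M xs x & rnorm x = rnorm x1.
  apply: (sums_transfer _ hx1) => n m; rewrite rnorm_interval_cross //.
  by congr rnorm; apply: eq_bigr => j /set_mem Mj; rewrite nxs.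
have [w hw Txw] := rnorm_components (components_image hpi (conj xsY hx)).
have [_ _ _ _ nT] := TT'.
have [y hy yw] : exists2 y, sums_to M (fun j => z (pi j) *: f j) y &
    rnorm y = rnorm w.
  apply: (sums_transfer _ hw) => n m; rewrite rnorm_interval_abs.
  congr rnorm; apply: eq_bigr => j /set_mem Mj; rewrite -nxs; last exact: piM.
  by congr (_ *: _); apply: rnorm_inj; rewrite nT.
exists y => //; apply: rnorm_inj; rewrite yw -Txw nT xx1.
by rewrite /rnorm x01.
Qed.

End PartPermutation.

Section PermutedIsometries.
Variables (pi : nat -> nat) (F : nat -> X -> X) (T : X -> X).
Hypotheses (pi_bij : set_bij M M pi)
  (pi_norm : forall z : nat -> R[i],
    eq_norm_sum M (fun j => z j *: f j) (fun j => z (pi j) *: f j))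
  (F_iso : forall j, M j -> surjective_isometry (Y (pi j)) (Y j) (F j))
  (TF : forall x xs, components M Y x xs ->
    components M Y (T x) (fun j => F j (xs (pi j)))).

Lemma rnorm_permuted x : rnorm (T x) = rnorm x.
Proof.
have [[ex _] _] := crossY; have [xs hx] := ex x.
have [w hw ->] := rnorm_components hx.
have [w' hw' ->] := rnorm_components (TF hx).
have [y hy wy] := pi_norm hw; rewrite /rnorm wy; congr (complex.Re `|_|).
apply: sums_to_uniq hw' _; apply: (sums_to_eq hy) => j Mj.
have [piM _ _] := pi_bij; have [_ _ nF] := F_iso Mj.
by rewrite nF //; apply: hx.1; exact: piM.
Qed.

(** The inverse permutation preserves convergence: a block of the permuted sum
    has, by invariance, the norm of a part of the original sum whose indices are
    all large. *)
Lemma sums_to_permuted (a : nat -> R[i]) (sg : nat -> nat) w :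
  (forall j, M j -> sg (pi j) = j) -> sums_to M (fun j => a j *: f j) w ->
  exists v, sums_to M (fun i => a (sg i) *: f i) v.
Proof.
move=> sgK hw; have [piM _ _] := pi_bij.
apply: sums_to_cauchy => eps e0; have /sums_toP/(_ _ e0)[N hN] := hw.
(* Indices j with [pi j] beyond this bound are at least N. *)
exists (\max_(j < N) pi j).+1 => n m Nn nm.
set v := \sum_(n <= i < m | i \in M) _.
have hv : sums_to M (fun i => coef M f v i *: f i) v by exact: coef_sum.
have [y hy vy] := pi_norm hv.
rewrite /rnorm vy -/(rnorm y); apply: le_lt_trans (hN _ (leqnn N)).
apply: (rnorm_part basis_f) => j.
have [Mj|nMj] := pselect (M j); last by right; exact: coef_out.
rewrite (coef_uniq basis_f hy Mj).
rewrite /v (coef_bigsum_basis basis_f) //.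
case: ifP => [/andP[_ /andP[npi _]]|]; last by right.
left; rewrite sgK // (coefB basis_f) (coef_bigsum_basis basis_f) //.
have Nj : (N <= j)%N.
  rewrite leqNgt; apply/negP => jN.
  have h : (pi j <= \max_(j < N) pi j)%N.
    by rewrite (bigD1 (Ordinal jN)) //= leq_maxl.
  by have := leq_trans npi h; rewrite leqNgt Nn.
by rewrite ltnNge Nj /= !andbF subr0 (coef_uniq basis_f hw Mj).
Qed.

Lemma surj_permuted y : exists x, T x = y.
Proof.
have [[ex _] _] := crossY; have [ys [ysY hy]] := ex y.
have [piM pi_inj pi_surj] := pi_bij.
have [xs' hxs'] : exists xs' : nat -> X, forall j, M j ->
    Y (pi j) (xs' j) /\ F j (xs' j) = ys j.
  apply: (choice_on (P := fun j x => Y (pi j) x /\ F j x = ys j) 0) => j Mj.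
  by have [_ /(_ _ (ysY _ Mj))[x Yx Fx] _] := F_iso Mj; exists x.
have [sg hsg] : exists sg : nat -> nat, forall i, M i -> M (sg i) /\ pi (sg i) = i.
  apply: (choice_on (P := fun i j => M j /\ pi j = i) 0%N) => i Mi.
  by have [j Mj pj] := pi_surj _ Mi; exists j.
have sgK j : M j -> sg (pi j) = j.
  move=> Mj; have [Ms ps] := hsg _ (piM _ Mj).
  by apply: pi_inj => //; rewrite inE.
pose xs i := xs' (sg i).
have xsY i : M i -> Y i (xs i).
  by move=> /hsg[Ms ps]; have [+ _] := hxs' _ Ms; rewrite ps.
have nxs i : M i -> `|xs i| = `|ys (sg i)|.
  move=> /hsg[Ms _]; have [Yx <-] := hxs' _ Ms.
  by have [_ _ nF] := F_iso Ms; rewrite nF.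
have [w hw _] := rnorm_components (conj ysY hy).
have [v hv] := sums_to_permuted sgK hw.
have [x hx _] : exists2 x, sums_to M xs x & rnorm x = rnorm v.
  apply: (sums_transfer _ hv) => n m; rewrite rnorm_interval_cross //.
  by congr rnorm; apply: eq_bigr => i /set_mem Mi; rewrite nxs.
exists x; have [_ hT] := TF (conj xsY hx).
apply: sums_to_uniq hT _; apply: (sums_to_eq hy) => j Mj.
by rewrite /xs sgK //; have [_ ->] := hxs' _ Mj.
Qed.

End PermutedIsometries.
End CrossProducts.

Lemma surjective_isometry_pair (R : realType) (X : completeNormedModType R[i])
    (T : {linear X -> X}) : surjective_isometry setT setT T ->
  exists T', isometry_pair T T'.
Proof.
case=> _ surjT nT.
have [T' T'K] : exists T' : X -> X, cancel T' T.
  have [y _|g hg] := @choice_on _ _ setT (fun y x => T x = y) 0.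
    by have [x _ <-] := surjT y I; exists x.
  by exists g => y; exact: hg.
have rT x : rnorm (T x) = rnorm x by rewrite /rnorm nT.
have injT x y : T x = T y -> x = y.
  move=> h; apply/eqP; rewrite -subr_eq0; apply/eqP; apply: rnorm0_eq0.
  by rewrite -rT linearB /= h subrr rnorm0.
exists T'; split=> // [c x y|c x y|x]; first exact: linearP.
  by apply: injT; rewrite linearP !T'K.
by apply: injT; rewrite T'K.
Qed.

Lemma indices_pair (k : option nat) c d : c <> d ->
  indices k = [set c; d] -> k = Some 2%N.
Proof.
move=> cd kE; have two i : indices k i -> i = c \/ i = d by rewrite kE.
have kc : indices k c by rewrite kE; left.
have kd : indices k d by rewrite kE; right.
case: k kc kd two {kE} => [n|] /= kc kd two; last first.
  have := two 0%N I; have := two 1%N I; have := two 2%N I; lia.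
congr Some; have [n3|] := ltnP 2 n; last by lia.
by have := two 0%N; have := two 1%N; have := two 2%N; lia.
Qed.

(** Merging the two coordinates leaves a multiple of the unit vector [e 0]. *)
Lemma one_block_l2 (R : realType) (X : completeNormedModType R[i])
    (e : nat -> X) : normalized_unconditional_basis `I_2 e ->
  same_hilbert_block `I_2 e 0%N 1%N -> is_lp 2%:E `I_2 e.
Proof.
move=> basis_e [//|[_ D0 D1 rot]] a x hx.
have x01 : x = a 0%N *: e 0%N + a 1%N *: e 1%N + 0.
  apply: sums_to_uniq hx _; have := sums_to_fin (D := `I_2) 2 (u := fun i => a i *: e i).
  rewrite big_mkcond !big_nat_recl //= big_geq // !mem_set //.
  rewrite addrA; apply => i; by rewrite ltnNge => /negP.
rewrite lpnorm2_I2 x01 rot ?(coef0 basis_e) // addr0 rnormZ (rnorm_e basis_e) //.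
by rewrite mulr1 rnormR ger0_norm // sqrtr_ge0.
Qed.

Theorem theorem3p2 (R : realType) (X X0 : completeNormedModType R[i])
  (k m : option nat) (e : nat -> X) (f : nat -> X0) (A : nat -> set nat)
  (basis_e : normalized_unconditional_basis (indices k) e)
  (basis_f : normalized_unconditional_basis (indices m) f)
  (factors_X : factors (indices k) e (indices m) f A)
  (not_l22_in_lines : ~ l22_in_lines k m e)
  (T : {linear X -> X}) :
  surjective_isometry setT setT T <->
  exists pi : nat -> nat,
    [/\ set_bij (indices m) (indices m) pi,
        forall z : nat -> R[i],
          eq_norm_sum (indices m) (fun j => z j *: f j)
                                  (fun j => z (pi j) *: f j) &
        exists F : nat -> X -> X,
          (forall j, indices m j ->
             linear_on (closed_span (A (pi j)) e) (F j) /\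
             surjective_isometry (closed_span (A (pi j)) e)
                                 (closed_span (A j) e) (F j)) /\
          (forall x xs,
             components (indices m) (fun j => closed_span (A j) e) x xs ->
             components (indices m) (fun j => closed_span (A j) e) (T x)
                        (fun j => F j (xs (pi j))))].
Proof.
have [partA crossY fact] := factors_X.
set D := indices k in basis_e partA fact *.
set M := indices m in basis_f partA crossY fact *.
pose Y j := closed_span (A j) e.
have YE j : M j -> Y j = coord_subspace D e (A j).
  by move=> Mj; apply: (closed_spanE basis_e); exact: (partition_sub partA Mj).
have crossA : cross_product M f (fun j => coord_subspace D e (A j)).
  have cE x xs : components M Y x xs <->
      components M (fun j => coord_subspace D e (A j)) x xs.
    by split=> -[h hx]; split=> // j Mj; have := h _ Mj; rewrite YE.
  have [[ex uniq] cr] := crossY; split; first split.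
  - by move=> x; have [xs /cE] := ex x; exists xs.
  - by move=> x xs ys /cE hx /cE hy; exact: uniq hx hy.
  - by move=> xs h; apply: cr => j Mj; have := h _ Mj; rewrite -YE.
have permuted : forall T T' : X -> X, isometry_pair T T' -> forall j, M j ->
    exists2 i, M i & forall x, coord_subspace D e (A j) x ->
      coord_subspace D e (A i) (T x).
  case: fact => [[maxA _]|[p [p1 lp_f lp_uniq indec]]]; last first.
    apply: (lp_image basis_e p1 partA crossA lp_f) => // j Mj nlp.
    by have := indec _ Mj nlp; rewrite -/(Y j) YE.
  have [proper|one] := pselect (forall c, D c ->
      exists2 d, D d & ~ same_hilbert_block D e c d).
    move=> U U' UU'; apply: (maximal_fiber_image basis_e partA maxA _ UU').
    exact: (maximal_fiber_saturated basis_e partA maxA proper).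
  exfalso; apply: not_l22_in_lines.
  have [c [Dc blk]] : exists c, D c /\ forall b, D b -> same_hilbert_block D e c b.
    apply: contrapT => h; apply: one => c Dc; apply: contrapT => h'; apply: h.
    exists c; split=> // b Db; apply: contrapT => nb; apply: h'; by exists b.
  have [d [cd DE [i [j [ME Ai Aj]]]]] :=
    maximal_fiber_one_block basis_e partA maxA Dc blk.
  have k2 := indices_pair cd DE.
  have ij : i <> j.
    by move=> E; apply: cd; have : A i c by [rewrite Ai]; rewrite E Aj.
  split=> //; first exact: indices_pair ij ME.
  rewrite -/D; have DI : D = `I_2 by rewrite /D k2.
  rewrite DI in basis_e blk *; apply: (one_block_l2 basis_e).
  exact: (block_trans basis_e (block_sym (blk 0%N erefl)) (blk 1%N erefl)).
split=> [isoT|[pi [pi_bij pi_norm [F [Fiso TF]]]]]; last first.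
  have F_iso j : M j -> surjective_isometry (Y (pi j)) (Y j) (F j).
    by move=> /Fiso[].
  split=> // [y _|x _].
    have [x <-] := surj_permuted basis_e basis_f YE crossY pi_bij pi_norm
      F_iso TF y.
    by exists x.
  apply: rnorm_inj; exact: (rnorm_permuted crossY pi_bij pi_norm F_iso TF).
have [T' TT'] := surjective_isometry_pair isoT.
have [pi hpi] := exists_part_permutation basis_e partA YE permuted TT'.
exists pi; split; first by case: hpi.
  exact: (norm_permutation basis_e basis_f partA YE crossY TT' hpi).
exists (fun=> T); split=> [j Mj|x xs].
  have [_ TY T'Y] := hpi; split; first by move=> c x y _ _; exact: linearP.
  have [_ _ nT] := isoT; split=> [x|y yY|x _]; last exact: nT.
    exact: TY.
  by exists (T' y); [exact: T'Y|case: TT'].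
exact: (components_image basis_e partA YE crossY TT' hpi).
Qed.
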